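(* Let $\Omega\subset\mathbb{R}^d$, $d\ge2$, be a bounded (polygonal) domain such that the closure of $\Omega$ is of uniformly positive reach $r_\Omega>0$. Let $$\mathcal{L}_1(u)=\sum_{i,j=1}^da^{ij}(x)\frac{\partial^2u}{\partial x_i\partial x_j}+\sum_{i=1}^db^i(x)\frac{\partial u}{\partial x_i}+c^1(x)u$$ with $a^{ij},b^i,c^1\in L^\infty(\Omega)$ satisfying: (symmetry) $a^{ij}=a^{ji}$; (ellipticity) there are $0<\lambda\le\Lambda$ with $\lambda\sum_i\eta_i^2\le\sum_{i,j}a^{ij}(x)\eta_i\eta_j\le\Lambda\sum_i\eta_i^2$ for all $\eta\in\mathbb{R}^d\setminus\{0\}$, $x\in\Omega$; (Cordès condition) there is $\epsilon\in(0,1]$ with $$\frac{\sum_{i,j=1}^d(a^{ij})^2}{\left(\sum_{i=1}^da^{ii}\right)^2}\le\frac1{d-1+\epsilon}\quad\text{a.e. in }\Omega.$$ Assume $1-\frac{\sqrt{1-\epsilon}}{A}-\frac{C_m}{A}>0$, with $A$ and $C_m$ as in the context. Let $u$ be the solution of $\mathcal{L}_1(u)=f$ in $\Omega$, $u=g$ on $\partial\Omega$, and let $u_s$ be the corresponding spline collocation minimizer with residual $\epsilon_1$, as defined in the context. Suppose that $u\in H^3(\Omega)$ and $u-u_s=0$ on $\partial\Omega$. Then $$\|u-u_s\|_{L^2(\Omega)}\le C\epsilon_1$$ for a positive constant $C$ depending on $\Omega$ and $A_2$, where $A_2>0$ is a constant such that $A_2\|v\|_{H^2}\le\|\mathcal{L}_1v\|_{L^2(\Omega)}$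 for all $v\in H^2(\Omega)\cap H^1_0(\Omega)$.
   Context: Norm: $\|v\|_{H^2}=\|v\|_{L^2(\Omega)}+\|\nabla v\|_{L^2(\Omega)}+\sum_{i,j=1}^d\|\frac{\partial^2 v}{\partial x_i\partial x_j}\|_{L^2(\Omega)}$. Constants: $A>0$ is a constant with $A\|v\|_{H^2}\le\|\Delta v\|_{L^2(\Omega)}$ for all $v\in H^2(\Omega)\cap H^1_0(\Omega)$. $\theta=\frac{\sum_{i=1}^da^{ii}}{\sum_{i,j=1}^d(a^{ij})^2}\in L^\infty(\Omega)$ and $C_m=\max\{\|\theta\|_\infty\max_i\|b^i\|_\infty\sqrt d,\ \|\theta\|_\infty\|c^1\|_\infty\}$. Reach: for non-empty $K\subseteq\mathbb{R}^d$, $r_K$ is the supremum of the $r$ such that every point of $\{x:\mathrm{dist}(x,K)<r\}$ has a unique projection in $K$; $K$ has positive reach if $r_K>0$. With $B(0,\epsilon)$ the closed ball, $E_\epsilon(K)=(K^c+B(0,\epsilon))^c$ for $\epsilon>0$, $E_0(K)=K$; $K$ has uniformly positive reach $r_0$ if for some $\epsilon_0>0$ every $E_\epsilon(K)$, $\epsilon\in[0,\epsilon_0]$, has positive reach at least $r_0$. Splines: $\triangle$ is a triangulation (tetrahedralization if $d=3$) of $\Omega$. $S_D^{-1}(\triangle)$ is the space of (discontinuous) piecewise polynomials of degree $D$ over $\triangle$; each $s$ in it is identified with its vector $\mathbf{c}$ of Bernstein–Bézier coefficients. $S^r_D(\triangle)=C^r(\Omega)\cap S^{-1}_D(\triangle)$,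 $r\ge2$, $D$ large enough ($D\ge3r+2$ if $d=2$, $D\ge6r+3$ if $d=3$). The domain points of degree $D'$ of a simplex $\langle v_1,\dots,v_{d+1}\rangle$ are $\frac{1}{D'}\sum_ki_kv_k$ with integers $i_k\ge0$, $\sum_ki_k=D'$; fix $D'>D$. Collocation: $\mathcal{K}\mathbf{c}$ is the vector of values of $\mathcal{L}_1s$ at the domain points of degree $D'$ of $\triangle$, $\mathbf{f}$ the vector of values of $f$ there; $B\mathbf{c}$ and $\mathbf{g}$ are the vectors of values of $s$ and $g$ at the domain points on $\partial\Omega$; $H\mathbf{c}=0$ and $H_0\mathbf{c}=0$ are the $C^r$ and $C^0$ smoothness conditions across interior faces. With fixed $\alpha,\beta,\gamma>0$, $u_s\in S_D^r(\triangle)$ is the spline whose coefficient vector minimizes $$\tfrac12\left(\alpha\|B\mathbf{c}-\mathbf{g}\|^2+\beta\|H\mathbf{c}\|^2+\gamma\|H_0\mathbf{c}\|^2\right)\quad\text{subject to }\mathcal{K}\mathbf{c}=\mathbf{f},$$ the constraint being satisfied up to the residual $\epsilon_1=\|\mathcal{K}\mathbf{c}-\mathbf{f}\|$ (a nearby minimization problem). As a standing property, $\|\mathcal{L}_1u_s-f\|_{L^2(\Omega)}\le\epsilon_1$. *)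

(* Defs.v *)
From HB Require Import structures.
From mathcomp Require Import all_boot all_order all_algebra.
From mathcomp Require Import all_classical all_reals all_analysis.

Set Implicit Arguments.
Unset Strict Implicit.
Unset Printing Implicit Defensive.

Import Order.TTheory GRing.Theory Num.Theory.
Import numFieldNormedType.Exports.

Local Open Scope classical_set_scope.
Local Open Scope ring_scope.

(* Points of R^d are row vectors 'rV[R]_d: they carry
   the library's topology and normed module structure; the product sigma-algebra
   and Lebesgue measure on them are added here. *)

Definition measure_row_display : measure_display -> measure_display.
Proof. exact. Qed.

Section measurable_row.
Context {d : measure_display} {T : measurableType d}.
Variable n : nat.

Let coords : 'I_n -> 'rV[T]_n -> T := fun i x => x ord0 i.

Let row_set0 : g_sigma_preimage coords set0.
Proof. exact: sigma_algebra0. Qed.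

Let row_setC A : g_sigma_preimage coords A -> g_sigma_preimage coords (~` A).
Proof. exact: sigma_algebraC. Qed.

Let row_bigcup (F : (set 'rV[T]_n)^nat) :
  (forall i, g_sigma_preimage coords (F i)) ->
  g_sigma_preimage coords (\bigcup_i (F i)).
Proof. exact: sigma_algebra_bigcup. Qed.

HB.instance Definition _ := @isMeasurable.Build (measure_row_display d)
  'rV[T]_n (g_sigma_preimage coords) row_set0 row_setC row_bigcup.

Lemma measurable_coord (i : 'I_n) :
  measurable_fun [set: 'rV[T]_n] (fun x : 'rV[T]_n => x ord0 i).
Proof.
move=> _ Y mY; rewrite setTI; apply: sub_sigma_algebra => /=.
rewrite -bigcup_seq/=; exists i => /=; first by rewrite mem_index_enum.
by exists Y => //; rewrite setTI.
Qed.

Lemma measurable_fun_coordP d1 (T1 : measurableType d1) (f : T1 -> 'rV[T]_n) :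
  (forall i, measurable_fun [set: T1] (fun x => f x ord0 i)) ->
  measurable_fun [set: T1] f.
Proof.
move=> mf.
have H : g_sigma_preimage (fun i => coords i \o f) `<=` measurable.
  apply: smallest_sub; first exact: sigma_algebra_measurable.
  rewrite -bigcup_seq/=; apply: bigcup_sub => i _ A [B mB <-].
  exact: mf.
rewrite g_sigma_preimage_comp in H.
by move=> _ A mA; apply: H; exists A.
Qed.

End measurable_row.
Section lebesgue_row.
Context {R : realType}.

Definition row_cons n (p : measurableTypeR R * 'rV[R]_n) : 'rV[R]_n.+1 :=
  \row_i oapp (fun j => p.2 ord0 j) (p.1 : R) (unlift ord0 i).

Lemma row_cons0 n p : @row_cons n p ord0 ord0 = p.1.
Proof. by rewrite mxE unlift_none. Qed.

Lemma row_consS n p j : @row_cons n p ord0 (lift ord0 j) = p.2 ord0 j.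
Proof. by rewrite mxE liftK. Qed.

Lemma measurable_row_cons n : measurable_fun setT (@row_cons n).
Proof.
apply: measurable_fun_coordP => i; case: (unliftP ord0 i) => [j|] ->.
- rewrite (_ : (fun _ => _) = (fun x : 'rV[R]_n => x ord0 j) \o snd).
    by apply: measurableT_comp; [exact: measurable_coord|exact: measurable_snd].
  by apply/funext => x; rewrite row_consS.
- rewrite (_ : (fun _ => _) = fst); first exact: measurable_fst.
  by apply/funext => x; rewrite row_cons0.
Qed.

Section row_prod.
Variables (n : nat) (mu : {sigma_finite_measure set 'rV[R]_n -> \bar R}).

Definition row_prod := pushforward (lebesgue_measure \x mu)%E (@row_cons n).

HB.instance Definition _ := Measure.copy row_prod
  (measure_function_pushforward__canonical__measure_function_Measure
    (lebesgue_measure \x mu)%E (@measurable_row_cons n)).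

Let row_prod_sigma_finite : sigma_finite setT row_prod.
Proof.
pose h (x : 'rV[R]_n.+1) : measurableTypeR R * 'rV[R]_n :=
  (x ord0 ord0, \row_j x ord0 (lift ord0 j)).
have mh : measurable_fun setT h.
  apply/measurable_fun_pairP; split; first exact: (measurable_coord ord0).
  apply: measurable_fun_coordP => i.
  have -> : (fun x => (snd \o h) x ord0 i) = (fun x : 'rV[R]_n.+1 => x ord0 (lift ord0 i)).
    by apply/funext => x; rewrite mxE.
  exact: measurable_coord.
have hK : cancel (@row_cons n) h.
  case=> x y; congr pair; first exact: row_cons0.
  by apply/rowP => j; rewrite mxE row_consS.
have /sigma_finiteP[F [TF ndF mF]] := sigma_finiteT (@lebesgue_measure R).
have /sigma_finiteP[G [TG ndG mG]] := sigma_finiteT mu.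
exists (fun k => h @^-1` (F k `*` G k)).
  apply/esym/seteqP; split => // x _.
  have [i _ Fi] : (\bigcup_i F i) (h x).1 by rewrite -TF.
  have [j _ Gj] : (\bigcup_j G j) (h x).2 by rewrite -TG.
  exists (maxn i j) => //; split.
  - by apply: (subsetPset _ _ (ndF i (maxn i j) (leq_maxl i j))).
  - by apply: (subsetPset _ _ (ndG j (maxn i j) (leq_maxr i j))).
move=> k; have [mFk Foo] := mF k; have [mGk Goo] := mG k; split.
  by rewrite -[X in measurable X]setTI; apply: mh => //; exact: measurableX.
rewrite /row_prod /pushforward -comp_preimage (_ : h \o _ = id); last first.
  by apply/funext => x /=; rewrite hK.
by rewrite preimage_id product_measure1E// lte_mul_pinfty// ge0_fin_numE.
Qed.

HB.instance Definition _ :=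
  Measure_isSigmaFinite.Build _ _ _ row_prod row_prod_sigma_finite.

End row_prod.

(* Product of d copies of the one-dimensional Lebesgue measure; lebesgue_row 0 is
   the point mass. *)
Fixpoint lebesgue_row n : {sigma_finite_measure set 'rV[R]_n -> \bar R} :=
  if n is n'.+1 then row_prod (lebesgue_row n') else \d_(0 : 'rV[R]_0).

End lebesgue_row.

Section geometry.
Context {R : realType} {d : nat}.
Implicit Types (x y : 'rV[R]_d) (K Om : set 'rV[R]_d).

(* The library norm on 'rV[R]_d is the sup norm, hence this one. *)
Definition enorm x : R := Num.sqrt (\sum_i x ord0 i ^+ 2).

Definition edist x K : R := inf [set enorm (x - y) | y in K].

Definition unique_projection K x : Prop :=
  exists! y, K y /\ enorm (x - y) = edist x K.

Definition reach K : \bar R :=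
  ereal_sup [set r%:E | r in
    [set r : R | forall x, edist x K < r -> unique_projection K x]].

(* E_eps(K) = (K^c + B(0, eps))^c; for eps = 0 this is K. *)
Definition erosion (eps : R) K : set 'rV[R]_d :=
  ~` [set z | exists x y, [/\ (~` K) x, enorm y <= eps & z = x + y]].

(* The reach is only defined for non-empty sets, whence the first conjunct. *)
Definition uniformly_positive_reach K (r0 : R) : Prop :=
  exists2 eps0 : R, 0 < eps0 &
    forall eps, 0 <= eps <= eps0 ->
      erosion eps K !=set0 /\ (r0%:E <= reach (erosion eps K))%E.

Definition bounded_domain Om : Prop :=
  [/\ open Om, connected Om, Om !=set0 & bounded_set Om].

Definition frontier Om : set 'rV[R]_d := closure Om `\` interior Om.

End geometry.

Section sobolev.
Context {R : realType} {d : nat}.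
Notation pt := 'rV[R]_d.
Implicit Types (Om : set pt) (u v w : pt -> R).

Definition partial (i : 'I_d) v : pt -> R := fun x => 'D_(delta_mx ord0 i) v x.

(* v is of class C^k on the open set Om. *)
Fixpoint Ck Om (k : nat) v : Prop :=
  (forall x, Om x -> {for x, continuous v}) /\
  if k is k'.+1 then
    forall i, (forall x, Om x -> derivable v x (delta_mx ord0 i)) /\
              Ck Om k' (partial i v)
  else True.

Definition test_function Om v : Prop :=
  (forall k, Ck setT k v) /\
  exists K : set pt, [/\ compact K, K `<=` Om & forall x, ~ K x -> v x = 0].

Definition LpO (p : \bar R) Om v : \bar R :=
  Lnorm (lebesgue_row d) p (EFin \o (v \_ Om)).

Definition L2norm := LpO 2%:E.
Definition Linfnorm := LpO +oo%E.

Definition in_L2 Om v : Prop :=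
  measurable_fun Om v /\ (L2norm Om v < +oo)%E.

Definition in_Linf Om v : Prop :=
  measurable_fun Om v /\ (Linfnorm Om v < +oo)%E.

Definition weak_partial Om (i : 'I_d) v w : Prop :=
  forall phi, test_function Om phi ->
    \int[lebesgue_row d]_(x in Om) (v x * partial i phi x) =
    - \int[lebesgue_row d]_(x in Om) (w x * phi x).

(* v belongs to H^k(Om). *)
Fixpoint sobolev Om (k : nat) v : Prop :=
  in_L2 Om v /\
  if k is k'.+1 then
    forall i, exists2 w, weak_partial Om i v w & sobolev Om k' w
  else True.

(* H^1_0(Om): closure of the test functions in H^1(Om). *)
Definition sobolev10 Om v : Prop :=
  in_L2 Om v /\
  exists Dv : 'I_d -> pt -> R,
    (forall i, in_L2 Om (Dv i) /\ weak_partial Om i v (Dv i)) /\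
    exists phi : nat -> pt -> R,
      [/\ forall n, test_function Om (phi n),
          L2norm Om (fun x => phi n x - v x) @[n --> \oo] --> 0%E &
          forall i, L2norm Om (fun x => partial i (phi n) x - Dv i x)
                      @[n --> \oo] --> 0%E].

(* v = w on the boundary of Om in the sense of traces. *)
Definition eq_on_boundary Om v w : Prop := sobolev10 Om (fun x => v x - w x).

(* v belongs to H^2(Om), with weak gradient Dv and weak Hessian D2v. Weak
   derivatives are unique only almost everywhere, so they are passed around
   together with the function; every quantity below is independent of the
   chosen representatives. *)
Definition H2_with Om v (Dv : 'I_d -> pt -> R) (D2v : 'I_d -> 'I_d -> pt -> R) :
    Prop :=
  [/\ in_L2 Om v,
      forall i, in_L2 Om (Dv i) /\ weak_partial Om i v (Dv i) &
      forall i j, in_L2 Om (D2v i j) /\ weak_partial Om j (Dv i) (D2v i j)].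

Definition H2norm Om v (Dv : 'I_d -> pt -> R) (D2v : 'I_d -> 'I_d -> pt -> R) :
    \bar R :=
  (L2norm Om v
   + L2norm Om (fun x => Num.sqrt (\sum_i Dv i x ^+ 2)%R)
   + \sum_i \sum_j L2norm Om (D2v i j))%E.

Definition second_order_op (a : 'I_d -> 'I_d -> pt -> R) (b : 'I_d -> pt -> R)
    (c1 : pt -> R)
    v (Dv : 'I_d -> pt -> R) (D2v : 'I_d -> 'I_d -> pt -> R) : pt -> R :=
  fun x => \sum_i \sum_j a i j x * D2v i j x + \sum_i b i x * Dv i x
           + c1 x * v x.

Definition laplacian (D2v : 'I_d -> 'I_d -> pt -> R) : pt -> R :=
  fun x => \sum_i D2v i i x.

Definition classical_op a b c1 v : pt -> R :=
  second_order_op a b c1 v (fun i => partial i v)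
    (fun i j => partial j (partial i v)).

Definition laplacian_bound Om (A : R) : Prop :=
  forall v Dv D2v, H2_with Om v Dv D2v -> sobolev10 Om v ->
    (A%:E * H2norm Om v Dv D2v <= L2norm Om (laplacian D2v))%E.

Definition operator_bound Om a b c1 (A2 : R) : Prop :=
  forall v Dv D2v, H2_with Om v Dv D2v -> sobolev10 Om v ->
    (A2%:E * H2norm Om v Dv D2v <=
     L2norm Om (second_order_op a b c1 v Dv D2v))%E.

Definition strong_solution Om a b c1 (f : pt -> R) u : Prop :=
  exists Dv D2v, H2_with Om u Dv D2v /\
    {ae lebesgue_row d,
      forall x, Om x -> second_order_op a b c1 u Dv D2v x = f x}.

Definition elliptic Om (a : 'I_d -> 'I_d -> pt -> R) : Prop :=
  exists lambda Lambda : R, 0 < lambda /\ lambda <= Lambda /\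
    forall (eta x : pt), eta != 0 -> Om x ->
      lambda * \sum_i eta ord0 i ^+ 2
        <= \sum_i \sum_j a i j x * eta ord0 i * eta ord0 j
        <= Lambda * \sum_i eta ord0 i ^+ 2.

Definition cordes Om (a : 'I_d -> 'I_d -> pt -> R) (eps : R) : Prop :=
  {ae lebesgue_row d, forall x, Om x ->
    (\sum_i \sum_j a i j x ^+ 2) / (\sum_i a i i x) ^+ 2
      <= (d%:R - 1 + eps)^-1}.

Definition theta (a : 'I_d -> 'I_d -> pt -> R) : pt -> R :=
  fun x => (\sum_i a i i x) / (\sum_i \sum_j a i j x ^+ 2).

Definition Cm Om a (b : 'I_d -> pt -> R) (c1 : pt -> R) : R :=
  let nrm v := fine (Linfnorm Om v) in
  Num.max
    (nrm (theta a) * \big[Num.max/0]_i nrm (b i) * Num.sqrt d%:R)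
    (nrm (theta a) * nrm c1).

End sobolev.

Section splines.
Context {R : realType} {d : nat}.
Notation pt := 'rV[R]_d.

(* A simplex is given by the ordered tuple of its d+1 vertices. *)
Definition simplex := 'I_d.+1 -> pt.
Implicit Types (v w : simplex) (Om : set pt).

(* The face of v spanned by the vertices indexed by S. *)
Definition face v (S : {set 'I_d.+1}) : set pt :=
  [set x | exists t : 'I_d.+1 -> R,
    [/\ forall k, 0 <= t k, forall k, k \notin S -> t k = 0,
        \sum_k t k = 1 & x = \sum_k t k *: v k]].

Definition hull v : set pt := face v finset.setT.

(* Row k is (1, v k): invertible iff the vertices are affinely independent. *)
Definition vertex_mx v : 'M[R]_(1 + d) :=
  \matrix_(k < 1 + d) (row_mx 1%:M (v k) : 'rV[R]_(1 + d)).

(* Barycentric coordinates of x, i.e. the solution t of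
   \sum_k t k = 1 and \sum_k t k *: v k = x. *)
Definition bary v (x : pt) : 'rV[R]_(1 + d) :=
  row_mx 1%:M x *m invmx (vertex_mx v).

(* Indices of the vertices of v which are also vertices of w. *)
Definition shared v w : {set 'I_d.+1} :=
  [set k | [exists l, v k == w l]]%SET.

Definition triangulation Om (m : nat) (V : 'I_m -> simplex) : Prop :=
  [/\ forall T, vertex_mx (V T) \in unitmx,
      closure Om = \bigcup_T hull (V T) &
      forall T T', T != T' ->
        shared (V T) (V T') != finset.setT /\
        hull (V T) `&` hull (V T') = face (V T) (shared (V T) (V T'))].

Definition multi_index (D : nat) :=
  {a : {ffun 'I_d.+1 -> 'I_D.+1} | (\sum_k (a k : nat))%N == D}.

Definition exponent D (a : multi_index D) (k : 'I_d.+1) : nat := val a k.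

(* Bernstein polynomial of degree \sum_k e k, in barycentric coordinates t. *)
Definition bernstein (e : 'I_d.+1 -> nat) (t : 'rV[R]_(1 + d)) : R :=
  ((\sum_k e k)%N`!)%:R / (\prod_k (e k)`!)%N%:R
  * \prod_k t ord0 (k : 'I_(1 + d)) ^+ e k.

(* Coefficients of an element of S_D^{-1}: one vector for each simplex. *)
Definition coefs (m D : nat) : Type := 'I_m -> multi_index D -> R.

Section collocation.
Variables (m D : nat) (V : 'I_m -> simplex).

Definition piece (cs : coefs m D) (T : 'I_m) : pt -> R :=
  fun x => \sum_a cs T a * bernstein (exponent a) (bary (V T) x).

(* The piecewise polynomial with coefficients cs. On common faces the value of
   one of the pieces is taken; the pieces agree there when the spline is
   continuous. *)
Definition spline (cs : coefs m D) : pt -> R :=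
  fun x => if [pick T | x \in hull (V T)] is Some T then piece cs T x else 0.

(* Membership in S^r_D = C^r(Om) \cap S^{-1}_D. *)
Definition smooth_spline Om (r : nat) (cs : coefs m D) : Prop :=
  Ck Om r (spline cs).

Definition domain_point (D' : nat) (T : 'I_m) (b : multi_index D') : pt :=
  D'%:R^-1 *: \sum_k (exponent b k)%:R *: V T k.

(* The vectors below are indexed by pairs (simplex, domain point of it), since a
   discontinuous spline has one value per simplex at a shared domain point. *)

(* || K c - f || *)
Definition collocation_residual D' a b c1 (f : pt -> R)
    (cs : coefs m D) : R :=
  Num.sqrt (\sum_T \sum_(xi : multi_index D')
    (classical_op a b c1 (piece cs T) (domain_point T xi)
     - f (domain_point T xi)) ^+ 2).

(* || B c - g ||^2 *)
Definition boundary_misfit Om D' (g : pt -> R) (cs : coefs m D) : R :=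
  \sum_T \sum_(xi : multi_index D' | domain_point T xi \in frontier Om)
    (piece cs T (domain_point T xi) - g (domain_point T xi)) ^+ 2.

(* Smoothness condition across the common facet of V T and V T', attached to the
   coefficient a of V T'. Let k0 be the index of the vertex of V T' opposite to
   the facet and n = exponent a k0. The condition of order n reads
     cs T' a = \sum_(|e| = n) cs T (base + e) * B_e (barycentric coordinates of
                                                  V T' k0 with respect to V T),
   where base is the multi-index a with the exponent of V T' k0 dropped and the
   exponents of the common vertices renumbered as in V T. The sum is indexed by
   a' = base + e. *)
Definition smoothness_defect (cs : coefs m D) (T T' : 'I_m) (k0 : 'I_d.+1)
    (a : multi_index D) : R :=
  let base k := (\sum_(l | V T' l == V T k) exponent a l)%N in
  cs T' a -
  \sum_(a' : multi_index D | [forall k, base k <= exponent a' k]%N)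
    cs T a' * bernstein (fun k => exponent a' k - base k)%N
                       (bary (V T) (V T' k0)).

(* Sum of the squares of the C^r smoothness conditions across the interior
   facets: || H c ||^2 for the given r and || H_0 c ||^2 for r = 0. Each
   interior facet is the common facet of exactly one pair T < T', and k0 ranges
   over the only vertex of V T' off it. *)
Definition smoothness_misfit (r : nat) (cs : coefs m D) : R :=
  \sum_(T < m) \sum_(T' < m | (T < T')%N && (#|shared (V T') (V T)| == d))
    \sum_(k0 | k0 \notin shared (V T') (V T))
      \sum_(a : multi_index D | (exponent a k0 <= r)%N)
        smoothness_defect cs T T' k0 a ^+ 2.

Definition spline_energy Om D' (r : nat) (alpha beta gamma : R) (g : pt -> R)
    (cs : coefs m D) : R :=
  2^-1 * (alpha * boundary_misfit Om D' g cs
          + beta * smoothness_misfit r cs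
          + gamma * smoothness_misfit 0 cs).

(* cs minimizes the energy subject to K c = f up to the residual eps1, which is
   attained by c. *)
Definition collocation_minimizer Om D' (r : nat) (alpha beta gamma : R)
    a b c1 (f g : pt -> R) (eps1 : R)
    (cs : coefs m D) : Prop :=
  collocation_residual D' a b c1 f cs = eps1 /\
  forall cs' : coefs m D, collocation_residual D' a b c1 f cs' <= eps1 ->
    spline_energy Om D' r alpha beta gamma g cs
      <= spline_energy Om D' r alpha beta gamma g cs'.

End collocation.
End splines.

Arguments coefs {R} d m D.

(* Main.v *)
(* With w = u - u_s, the boundary hypothesis puts w in H^1_0, so the a priori
   bound gives A2 |w|_{L^2} <= A2 |w|_{H^2} <= |L_1 w| = |f - L_1 u_s| <= eps1.
   This needs u_s in H^2(Om). At every point the spline coincides with one of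
   finitely many polynomials, and so do its partial derivatives of order 1 and 2
   with those of one of these polynomials, whence all of them are bounded; and
   classical derivatives are weak ones, by Fubini and the fundamental theorem of
   calculus.
   The a priori bound exists because the Cordes condition makes theta a close to
   the identity: |theta L_1 v - Delta v| is at most
   sqrt(1 - eps) |D^2 v| + C_m (|Dv| + |v|) almost everywhere. *)

Require Import Defs.
From HB Require Import structures.
From mathcomp Require Import all_boot all_order all_algebra.
From mathcomp Require Import all_classical all_reals all_analysis.
From mathcomp Require Import measurable_realfun ess_sup_inf.
From mathcomp Require Import ring lra.

Set Implicit Arguments.
Unset Strict Implicit.
Unset Printing Implicit Defensive.

Import Order.TTheory GRing.Theory Num.Theory.
Import numFieldNormedType.Exports.

Local Open Scope classical_set_scope.
Local Open Scope ring_scope.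

(** * Lebesgue measure on row vectors *)

Section row_measure.
Context {R : realType}.

Lemma row_coord_le_norm n (x : 'rV[R]_n) i : `|x ord0 i| <= `|x|.
Proof.
by rewrite [leRHS]/Num.norm/= mx_normrE
  (le_bigmax _ (fun ij => `|x ij.1 ij.2|) (ord0, i)).
Qed.

(** The sigma-algebra on rows is generated by the coordinates, so an open set must be built from
    boxes: it is the countable union of the boxes with rational centre and half-width [1 / (k + 1)]
    that it contains. *)
Lemma open_measurable_row n (U : set 'rV[R]_n) : open U -> measurable U.
Proof.
move=> oU.
pose box (p : 'rV[rat]_n * nat) := [set x : 'rV[R]_n |
  forall i, `|x ord0 i - ratr (p.1 ord0 i)| < p.2.+1%:R^-1].
have mbox p : measurable (box p).
  have -> : box p = \bigcap_(i in [set: 'I_n]) (setT `&`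
      (fun x : 'rV[R]_n => x ord0 i) @^-1`
        `](ratr (p.1 ord0 i) - p.2.+1%:R^-1),
          (ratr (p.1 ord0 i) + p.2.+1%:R^-1)[%classic).
    apply/seteqP; split => x /= xp i.
      by move=> _; split => //=; rewrite in_itv/= -ltr_distl.
    by have [_ /=] := xp i I; rewrite in_itv/= -ltr_distl.
  apply: fin_bigcap_measurable => // i _.
  exact: measurable_coord.
have -> : U = \bigcup_p (if `[< box p `<=` U >] then box p else set0).
  apply/seteqP; split => [x Ux|x [p _]]; last by case: asboolP => [h /h|_ []].
  have /nbhs_ballP[e /= e0 eU] := open_nbhs_nbhs (conj oU Ux).
  pose k := Num.trunc (2 / e).
  have ke : k.+1%:R^-1 < e / 2.
    rewrite -[ltRHS]invrK ltf_pV2 ?posrE ?invr_gt0 ?divr_gt0 ?ltr0n//.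
    by rewrite invf_div truncnS_gt.
  have q_ i : {q : rat | `|x ord0 i - ratr q| < k.+1%:R^-1}.
    apply: cid; have [|q] :=
      @rat_in_itvoo R (x ord0 i - k.+1%:R^-1) (x ord0 i + k.+1%:R^-1).
      by rewrite ltrD2l -subr_gt0 opprK addr_gt0.
    by rewrite in_itv/= -ltr_distl distrC => ?; exists q.
  exists (\row_i sval (q_ i), k) => //.
  rewrite asboolT => [i /=|]; first by rewrite mxE; exact: (svalP (q_ i)).
  move=> y /= yp; apply: eU; split => // i j; rewrite (ord1 i).
  rewrite /ball/= -(subrK (ratr (sval (q_ j))) (x ord0 j)) -addrA.
  rewrite (le_lt_trans (ler_normD _ _))// (splitr e) ltrD//.
    exact: lt_trans (svalP (q_ j)) ke.
  by have := yp j; rewrite mxE distrC => /lt_trans; apply.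
apply: countable_bigcupT_measurable => [|p]; first exact: countableP.
by case: ifP.
Qed.

Lemma open_continuous_measurable_fun_row n (U : set 'rV[R]_n)
    (f : 'rV[R]_n -> R) :
  open U -> (forall x, U x -> {for x, continuous f}) -> measurable_fun U f.
Proof.
move=> oU cf; apply: (measurability _ (RGenOpens.measurableE R)).
move=> _ [_ [a [b ->] <-]]; apply: open_measurable_row.
rewrite openE => x [Ux fx]; apply: filterI; first exact: open_nbhs_nbhs.
by apply: cf => //; apply: open_nbhs_nbhs; split => //; exact: interval_open.
Qed.

Lemma measurable_row_box n (N : R) :
  measurable [set x : 'rV[R]_n | forall i, `|x ord0 i| <= N].
Proof.
have -> : [set x : 'rV[R]_n | forall i, `|x ord0 i| <= N] =
  \bigcap_(i in [set: 'I_n]) (setT `&`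
    (fun x : 'rV[R]_n => x ord0 i) @^-1` `[(- N), N]%classic).
  apply/seteqP; split => x /= xp i.
    by move=> _; split => //=; rewrite in_itv/= -ler_norml.
  by have [_ /=] := xp i I; rewrite in_itv/= -ler_norml.
apply: fin_bigcap_measurable => // i _.
exact: measurable_coord.
Qed.

(** Induction on the dimension: [row_cons] pulls the box back to an interval times a box, and in
    dimension 0 the measure is a Dirac mass, at most 1. *)
Lemma lebesgue_row_box_lty n (N : R) :
  (lebesgue_row n [set x : 'rV[R]_n | forall i, `|x ord0 i| <= N]%R < +oo)%E.
Proof.
elim: n => [|n IHn].
  rewrite /= (@le_lt_trans _ _ 1%E) ?ltry//.
  by rewrite diracE lee_fin lern1 leq_b1.
rewrite /= /row_prod /pushforward.
rewrite (_ : _ @^-1` _ = `[(- N), N]%classic `*`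
    [set x : 'rV[R]_n | forall i, `|x ord0 i| <= N]); last first.
  apply/seteqP; split => [[t y]/= H|[t y]/= [H1 H2] i].
    split; first by have := H ord0; rewrite row_cons0 in_itv/= ler_norml.
    by move=> i; have := H (lift ord0 i); rewrite row_consS.
  case: (unliftP ord0 i) => [j|] ->; first by rewrite row_consS.
  by move: H1; rewrite row_cons0 in_itv/= -ler_norml.
have mbox := @measurable_row_box n N.
have lN : (lebesgue_measure [set` `[- N, N]%R] < +oo :> \bar R)%E.
  by rewrite lebesgue_measure_itv/=; case: ifP => // _; rewrite ltry.
by rewrite product_measure1E// lte_mul_pinfty// ge0_fin_numE.
Qed.

Lemma bounded_lebesgue_row_lty n (D : set 'rV[R]_n) :
  measurable D -> bounded_set D -> (lebesgue_row n D < +oo)%E.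
Proof.
(* [bounded_set] bounds the norms only by reals strictly above [M], whence [M + 1]. *)
move=> mD [M [_ HM]]; apply: le_lt_trans (lebesgue_row_box_lty n (M + 1)).
apply: le_measure; rewrite ?inE//; last first.
  move=> x Dx i; apply: le_trans (HM (M + 1) _ x Dx); last by rewrite ltrDl.
  exact: row_coord_le_norm.
exact: measurable_row_box.
Qed.

End row_measure.

(** * L2 norms *)

Section L2norm.
Context {R : realType} {d : nat}.
Variable Om : set 'rV[R]_d.
Hypothesis mOm : measurable Om.
Implicit Types v w : 'rV[R]_d -> R.

Local Notation mu := (lebesgue_row d : {measure set 'rV[R]_d -> \bar R}).

Lemma L2normE v :
  L2norm Om v = ((\int[mu]_(x in Om) (v x ^+ 2)%:E) `^ 2^-1)%E.
Proof.
rewrite /L2norm /LpO unlock /=; congr (_ `^ _)%E.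
rewrite [RHS]integral_mkcond; apply: eq_integral => x _.
rewrite /= !patchE; case: ifPn => _; last first.
  by rewrite normr0 powR0 ?pnatr_eq0.
by rewrite powR_mulrn// real_normK ?num_real.
Qed.

Lemma L2norm_ge0 v : (0 <= L2norm Om v)%E.
Proof. exact: Lnorm_ge0. Qed.

Lemma measurable_sqr_EFin v :
  measurable_fun Om v -> measurable_fun Om (fun x => (v x ^+ 2)%:E).
Proof. by move=> mv; apply/measurable_EFinP; exact: measurable_funX. Qed.

Lemma le_L2norm v w : measurable_fun Om v -> measurable_fun Om w ->
  {ae mu, forall x, Om x -> `|v x| <= `|w x|} ->
  (L2norm Om v <= L2norm Om w)%E.
Proof.
move=> mv mw vw; rewrite !L2normE; apply: gt0_ler_poweR.
- by rewrite invr_ge0.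
- by rewrite in_itv/= leey andbT; apply: integral_ge0 => x _; rewrite lee_fin sqr_ge0.
- by rewrite in_itv/= leey andbT; apply: integral_ge0 => x _; rewrite lee_fin sqr_ge0.
apply: ae_ge0_le_integral => //.
- by move=> x _; rewrite lee_fin sqr_ge0.
- exact: measurable_sqr_EFin.
- by move=> x _; rewrite lee_fin sqr_ge0.
- exact: measurable_sqr_EFin.
apply: filterS vw => x vwx Omx; rewrite lee_fin.
rewrite -[v x ^+ 2]real_normK ?num_real// -[w x ^+ 2]real_normK ?num_real//.
by rewrite lerXn2r ?nnegrE// vwx.
Qed.

Lemma L2normD v w : measurable_fun Om v -> measurable_fun Om w ->
  (L2norm Om (fun x => v x + w x)%R <= L2norm Om v + L2norm Om w)%E.
Proof.
move=> /measurable_restrictT => /(_ mOm) mv /measurable_restrictT => /(_ mOm) mw.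
have := @eminkowski _ _ R mu _ _ 2%:E mv mw.
rewrite lee_fin ler1n => /(_ isT); apply: le_trans.
rewrite le_eqVlt; apply/orP; left; apply/eqP.
apply: eq_Lnorm => x /=; rewrite !patchE.
by case: ifP => // _; rewrite addr0.
Qed.

Lemma L2normZ (k : R) v : measurable_fun Om v ->
  L2norm Om (fun x => k * v x)%R = (`|k|%:E * L2norm Om v)%E.
Proof.
move=> mv; rewrite !L2normE.
under eq_integral do rewrite exprMn EFinM.
rewrite ge0_integralZl_EFin ?sqr_ge0//; last 2 first.
- by move=> x _; rewrite lee_fin sqr_ge0.
- exact: measurable_sqr_EFin.
rewrite poweRM ?lee_fin ?sqr_ge0//; last first.
  by apply: integral_ge0 => x _; rewrite lee_fin sqr_ge0.
by rewrite poweR12_sqrt ?lee_fin ?sqr_ge0//= sqrtr_sqr.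
Qed.

Lemma L2norm0 : L2norm Om (fun=> 0) = 0%E.
Proof.
rewrite L2normE; under eq_integral do rewrite expr0n/=.
by rewrite integral0 poweR0r// invr_neq0.
Qed.

Lemma L2norm_sum (I : Type) (s : seq I) (f : I -> 'rV[R]_d -> R) :
  (forall i, measurable_fun Om (f i)) ->
  (L2norm Om (fun x => \sum_(i <- s) f i x)%R <= \sum_(i <- s) L2norm Om (f i))%E.
Proof.
move=> mf; elim: s => [|i s IHs].
  by rewrite big_nil; under eq_fun do rewrite big_nil; rewrite L2norm0.
under eq_fun do rewrite big_cons; rewrite big_cons.
apply: le_trans (L2normD _ _) _ => //; first exact: measurable_sum.
exact: leeD.
Qed.

Lemma in_L2Z (k : R) v : in_L2 Om v -> in_L2 Om (fun x => k * v x).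
Proof.
move=> [mv Nv]; split; first exact: measurable_funM.
by rewrite L2normZ// lte_mul_pinfty.
Qed.

Lemma in_L2D v w : in_L2 Om v -> in_L2 Om w -> in_L2 Om (fun x => v x + w x).
Proof.
move=> [mv Nv] [mw Nw]; split; first exact: measurable_funD.
by apply: le_lt_trans (L2normD mv mw) _; rewrite lte_add_pinfty.
Qed.

Lemma in_L2B v w : in_L2 Om v -> in_L2 Om w -> in_L2 Om (fun x => v x - w x).
Proof.
move=> v2 /(in_L2Z (-1)) w2; have := in_L2D v2 w2.
by under eq_fun do rewrite mulN1r.
Qed.

Lemma ae_Linfnorm v : (Linfnorm Om v < +oo)%E ->
  {ae mu, forall x, Om x -> `|v x| <= fine (Linfnorm Om v)}.
Proof.
rewrite /Linfnorm /LpO unlock.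
(* [Lnorm] at infinity is an essential supremum only when the whole space has positive measure;
   otherwise the whole space is a null set and every property holds almost everywhere. *)
case: ifPn => [mu0 supy|mu0 _]; last first.
  suff muT : mu setT = 0%E by exists setT; split => //; exact: measurableT.
  by apply/eqP; rewrite eq_le measure_ge0 andbT leNgt.
have sup0 : (0 <= ess_sup mu (abse \o (EFin \o (v \_ Om))))%E.
  by apply: ess_sup_gee => //; apply: nearW => x /=.
have supfin : ess_sup mu (abse \o (EFin \o (v \_ Om))) \is a fin_num.
  by rewrite ge0_fin_numE.
apply: filterS (ess_sup_ge mu (abse \o (EFin \o (v \_ Om)))) => x /= + Omx.
by rewrite -lee_fin fineK// patchE mem_set.
Qed.

Lemma Linfnorm_le v (M : R) : 0 <= M -> (forall x, Om x -> `|v x| <= M) ->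
  (Linfnorm Om v <= M%:E)%E.
Proof.
move=> M0 vM; rewrite /Linfnorm /LpO unlock; case: ifP => // _.
apply/ess_supP; apply: nearW => x /=; rewrite lee_fin patchE.
by case: ifPn => [/set_mem/vM|]//; rewrite normr0.
Qed.

Hypothesis Om_fin : (mu Om < +oo)%E.

Lemma bounded_in_L2 v (M : R) : measurable_fun Om v ->
  (forall x, Om x -> `|v x| <= M) -> in_L2 Om v.
Proof.
move=> mv vM; split => //; rewrite L2normE poweR_lty//.
apply: (@le_lt_trans _ _ (\int[mu]_(x in Om) (M ^+ 2)%:E)%E).
  apply: ge0_le_integral => //.
  - by move=> x _; rewrite lee_fin sqr_ge0.
  - exact: measurable_sqr_EFin.
  move=> x Omx; rewrite lee_fin -[v x ^+ 2]real_normK ?num_real//.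
  have := vM _ Omx => vM'; rewrite lerXn2r ?nnegrE//.
  exact: le_trans vM'.
by rewrite integral_cst//= lte_mul_pinfty// lee_fin sqr_ge0.
Qed.

(** [|v| <= 1 + v ^+ 2], and constants are integrable because [Om] has finite measure. *)
Lemma in_L2_integrable v : in_L2 Om v -> mu.-integrable Om (EFin \o v).
Proof.
move=> [mv]; rewrite L2normE => /lty_poweRy.
rewrite invr_eq0 pnatr_eq0 => /(_ isT) iv.
have i2 : mu.-integrable Om (fun x => (v x ^+ 2)%:E).
  apply/integrableP; split; first exact: measurable_sqr_EFin.
  by under eq_integral do rewrite /= ger0_norm ?sqr_ge0//.
have i1 : mu.-integrable Om (EFin \o cst (1 : R)).
  apply: measurable_bounded_integrable => //.
  by exists 1; split => // y y1 x _ /=; rewrite normr1 ltW.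
apply: (le_integrable mOm _ _ (integrableD mOm i1 i2)).
  exact/measurable_EFinP.
move=> x _ /=; rewrite lee_fin [leRHS]ger0_norm; last by rewrite addr_ge0 ?sqr_ge0.
rewrite -[v x ^+ 2]real_normK ?num_real//.
have [v1|v1] := leP `|v x| 1; first by rewrite (le_trans v1)// lerDl sqr_ge0.
by rewrite -[leLHS]add0r lerD// expr2 ler_peMr// ltW.
Qed.

Lemma in_L2_integrableM v w (M : R) : in_L2 Om v -> measurable_fun Om w ->
  (forall x, Om x -> `|w x| <= M) ->
  mu.-integrable Om (EFin \o (fun x => v x * w x)).
Proof.
move=> v2 mw wM; apply: (integrableMl mOm (in_L2_integrable v2) mw).
exists M; split => [|y My x Omx]; first exact: num_real.
exact: le_trans (wM _ Omx) (ltW My).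
Qed.

End L2norm.

(** * The Cordes estimate *)

Section pointwise.
Context {R : realType}.

(** The non-negative sum of the [(x i * Y - y i * P) ^+ 2] equals [Y * (X * Y - P ^+ 2)]. One
    divides by [Y], unless [Y = 0], when all [y i] vanish. *)
Lemma cauchy_schwarz_sum (I : finType) (x y : I -> R) :
  (\sum_i x i * y i) ^+ 2 <= (\sum_i x i ^+ 2) * (\sum_i y i ^+ 2).
Proof.
set X := \sum_i x i ^+ 2; set Y := \sum_i y i ^+ 2; set P := \sum_i x i * y i.
have Y0 : 0 <= Y by apply: sumr_ge0 => i _; exact: sqr_ge0.
have [Y_eq0|Yn0] := eqVneq Y 0.
  have y0 i : y i = 0.
    have /psumr_eq0P := Y_eq0; move/(_ (fun i _ => sqr_ge0 (y i)) i isT).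
    by move/eqP; rewrite sqrf_eq0 => /eqP.
  rewrite /P; under eq_bigr do rewrite y0 mulr0.
  by rewrite big1_eq Y_eq0 mulr0 expr0n.
have Ypos : 0 < Y by rewrite lt_neqAle eq_sym Yn0.
have : 0 <= \sum_i (x i * Y - y i * P) ^+ 2.
  by apply: sumr_ge0 => i _; exact: sqr_ge0.
have -> : \sum_i (x i * Y - y i * P) ^+ 2 = Y * (X * Y - P ^+ 2).
  transitivity (\sum_i (Y ^+ 2 * x i ^+ 2 - (2 * Y * P) * (x i * y i)
                        + P ^+ 2 * y i ^+ 2)).
    by apply: eq_bigr => i _; ring.
  rewrite big_split/= sumrB -!mulr_sumr -/X -/Y -/P; ring.
by rewrite pmulr_rge0// subr_ge0.
Qed.

(** Each [x i ^+ 2] is at most [|x i|] times the whole sum of absolute values. *)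
Lemma sqrt_sum_sqr_le (I : finType) (x : I -> R) :
  Num.sqrt (\sum_i x i ^+ 2) <= \sum_i `|x i|.
Proof.
have S0 : 0 <= \sum_i `|x i| by apply: sumr_ge0.
rewrite -[leRHS]ger0_norm// -sqrtr_sqr ler_wsqrtr//.
rewrite expr2 mulr_suml; apply: ler_sum => i _.
rewrite -real_normK ?num_real// expr2 ler_wpM2l//.
by rewrite (bigD1 i)//= lerDl sumr_ge0.
Qed.

(** Cauchy-Schwarz against the constant 1; this is the source of the factor sqrt d in [Cm]. *)
Lemma sum_norm_le_sqrt n (x : 'I_n -> R) :
  \sum_i `|x i| <= Num.sqrt n%:R * Num.sqrt (\sum_i x i ^+ 2).
Proof.
have S0 : 0 <= \sum_i `|x i| by apply: sumr_ge0.
rewrite -sqrtrM ?ler0n// -[leLHS]ger0_norm// -sqrtr_sqr ler_wsqrtr//.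
have := cauchy_schwarz_sum (fun=> 1) (fun i => `|x i|).
under eq_bigr do rewrite mul1r.
under [X in _ <= X * _ -> _]eq_bigr do rewrite expr1n.
rewrite sumr_const card_ord => /le_trans; apply.
rewrite ler_wpM2l//; apply: ler_sum => i _.
by rewrite real_normK ?num_real.
Qed.

(* The Cordes condition says exactly that [theta a - I] has squared Frobenius
   norm [d - (tr a)^2 / |a|^2 <= 1 - eps]. *)
Lemma cordes_trace_bound d (a m : 'I_d -> 'I_d -> R) (eps : R) :
  0 < d%:R - 1 + eps ->
  0 < \sum_i a i i -> 0 < \sum_i \sum_j a i j ^+ 2 ->
  (\sum_i \sum_j a i j ^+ 2) / (\sum_i a i i) ^+ 2 <= (d%:R - 1 + eps)^-1 ->
  `|(\sum_i a i i) / (\sum_i \sum_j a i j ^+ 2) * (\sum_i \sum_j a i j * m i j)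
    - \sum_i m i i|
  <= Num.sqrt (1 - eps) * \sum_i \sum_j `|m i j|.
Proof.
set T := \sum_i a i i; set N := \sum_i \sum_j a i j ^+ 2.
move=> de0 T0 N0 NT; set t := T / N.
(* The entries of [theta a - I], indexed by pairs so that the double sum becomes a single scalar
   product. *)
pose x (p : 'I_d * 'I_d) := t * a p.1 p.2 - (p.1 == p.2)%:R.
have diagE (F : 'I_d -> 'I_d -> R) :
    \sum_p F p.1 p.2 * (p.1 == p.2)%:R = \sum_i F i i.
  rewrite -(pair_bigA _ (fun i j => F i j * (i == j)%:R)) /=.
  apply: eq_bigr => i _; rewrite (bigD1 i)//= eqxx mulr1 big1 ?addr0// => j ji.
  by rewrite eq_sym (negbTE ji) mulr0.
have -> : t * (\sum_i \sum_j a i j * m i j) - \sum_i m i i =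
          \sum_p x p * m p.1 p.2.
  rewrite -(diagE m) pair_bigA mulr_sumr -sumrB.
  by apply: eq_bigr => p _; rewrite /x; ring.
have x2 : \sum_p x p ^+ 2 = d%:R - T ^+ 2 / N.
  have -> : \sum_p x p ^+ 2 = \sum_p (t ^+ 2 * a p.1 p.2 ^+ 2
      - 2 * t * (a p.1 p.2 * (p.1 == p.2)%:R) + (p.1 == p.2)%:R).
    apply: eq_bigr => p _; rewrite /x; case: (p.1 == p.2); rewrite ?mulr1n ?mulr0n; ring.
  rewrite big_split/= sumrB -!mulr_sumr (diagE a).
  have -> : \sum_(p : 'I_d * 'I_d) (p.1 == p.2)%:R = d%:R :> R.
    under eq_bigr do rewrite -[_%:R]mul1r.
    by rewrite (diagE (fun _ _ => 1)) sumr_const card_ord.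
  rewrite -(pair_bigA _ (fun i j => a i j ^+ 2)) /= -/T -/N /t.
  by field; rewrite gt_eqF.
have xe : \sum_p x p ^+ 2 <= 1 - eps.
  rewrite x2; suff : d%:R - 1 + eps <= T ^+ 2 / N by lra.
  move: NT; rewrite -[N / _]invrK invf_div lef_pV2 ?posrE//.
  by rewrite divr_gt0// exprn_gt0.
(* Cauchy-Schwarz leaves two Frobenius norms. That of [m] is enlarged to the sum of the absolute
   values of its entries, because [H2norm] adds up the norms of the individual second
   derivatives. *)
rewrite -sqrtr_sqr; apply: le_trans (ler_wsqrtr (cauchy_schwarz_sum _ _)) _.
rewrite sqrtrM; last by apply: sumr_ge0 => p _; exact: sqr_ge0.
apply: ler_pM; rewrite ?sqrtr_ge0 ?ler_wsqrtr//.
by rewrite pair_bigA; apply: sqrt_sum_sqr_le.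
Qed.

End pointwise.

(** * Pointwise bound on the Laplacian *)

Section operator_bound.
Context {R : realType} {d : nat}.
Variable Om : set 'rV[R]_d.
Hypothesis mOm : measurable Om.

Local Notation mu := (lebesgue_row d : {measure set 'rV[R]_d -> \bar R}).

Lemma measurable_fun_sqrt (v : 'rV[R]_d -> R) :
  measurable_fun Om v -> measurable_fun Om (fun x => Num.sqrt (v x)).
Proof.
move=> mv; apply: measurableT_comp => //.
by apply: continuous_measurable_fun; exact: sqrt_continuous.
Qed.

(** Ellipticity tested on the unit vectors gives [a i i >= la]. Hence the trace is positive and the
    squared Frobenius norm is at least [la] times the trace, so [theta <= 1 / la]. *)
Lemma elliptic_theta (a : 'I_d -> 'I_d -> 'rV[R]_d -> R) :
  (0 < d)%N -> elliptic Om a -> exists2 M : R, 0 < M &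
    forall x, Om x -> [/\ 0 < \sum_i a i i x,
      0 < \sum_i \sum_j a i j x ^+ 2 & 0 <= theta a x <= M].
Proof.
move=> d0 [la [La [la0 [_ H]]]]; exists la^-1; first by rewrite invr_gt0.
move=> x Omx.
have aii i : la <= a i i x.
  have := H (delta_mx ord0 i) x _ Omx.
  have sq (F : 'I_d -> R) : \sum_j F j * (delta_mx ord0 i : 'rV[R]_d) ord0 j = F i.
    rewrite (bigD1 i)//= !mxE !eqxx mulr1 big1 ?addr0// => j ji.
    by rewrite mxE (negbTE ji) mulr0.
  have -> : \sum_j ((delta_mx ord0 i : 'rV[R]_d) ord0 j) ^+ 2 = 1.
    under eq_bigr do rewrite expr2.
    by rewrite sq mxE !eqxx.
  rewrite (eq_bigr (fun k => a k i x * (delta_mx ord0 i : 'rV[R]_d) ord0 k));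
    last by move=> k _; rewrite sq.
  rewrite sq mulr1 => /(_ _)/andP[]//.
  apply/eqP => /matrixP/(_ ord0 i); rewrite !mxE !eqxx => /eqP.
  by rewrite oner_eq0.
have a0 i : 0 < a i i x by apply: lt_le_trans (aii i).
have T0 : 0 < \sum_i a i i x.
  rewrite (bigD1 (Ordinal d0))//= ltr_pwDl//.
  by apply: sumr_ge0 => i _; exact: ltW.
have NT : la * \sum_i a i i x <= \sum_i \sum_j a i j x ^+ 2.
  rewrite mulr_sumr; apply: ler_sum => i _; rewrite (bigD1 i)//=.
  apply: (@le_trans _ _ (a i i x ^+ 2)); first by rewrite expr2 ler_wpM2r// ltW.
  by rewrite lerDl; apply: sumr_ge0 => j _; exact: sqr_ge0.
have N0 : 0 < \sum_i \sum_j a i j x ^+ 2.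
  by apply: lt_le_trans NT; rewrite mulr_gt0.
split => //; apply/andP; split; first by rewrite divr_ge0// ltW.
by rewrite /theta ler_pdivrMr// mulrC ler_pdivlMr// mulrC.
Qed.

(** Delta v is split as theta L v, minus theta times the lower order terms, minus the difference
    between theta a : D^2 v and Delta v, which [cordes_trace_bound] controls. With the sup norms of
    theta, b and c1 for [Th], [B] and [C], the maximum becomes [Cm]. *)
Lemma cordes_pointwise (a : 'I_d -> 'I_d -> 'rV[R]_d -> R)
    (b : 'I_d -> 'rV[R]_d -> R) (c1 : 'rV[R]_d -> R) (eps : R)
    v (Dv : 'I_d -> 'rV[R]_d -> R) (D2v : 'I_d -> 'I_d -> 'rV[R]_d -> R)
    (x : 'rV[R]_d) (Th B C : R) :
  0 < d%:R - 1 + eps -> 0 < \sum_i a i i x ->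
  0 < \sum_i \sum_j a i j x ^+ 2 ->
  (\sum_i \sum_j a i j x ^+ 2) / (\sum_i a i i x) ^+ 2 <= (d%:R - 1 + eps)^-1 ->
  0 <= theta a x <= Th -> (forall i, `|b i x| <= B) -> `|c1 x| <= C ->
  `|laplacian D2v x| <=
  Th * `|second_order_op a b c1 v Dv D2v x|
  + Num.sqrt (1 - eps) * \sum_i \sum_j `|D2v i j x|
  + Num.max (Th * B * Num.sqrt d%:R) (Th * C)
    * (Num.sqrt (\sum_i Dv i x ^+ 2) + `|v x|).
Proof.
move=> de0 T0 N0 NT /andP[th0 thTh] bB cC.
have Th0 : 0 <= Th by exact: le_trans thTh.
have := @cordes_trace_bound R d (fun i j => a i j x) (fun i j => D2v i j x)
  eps de0 T0 N0 NT.
rewrite -/(theta a x) -/(laplacian D2v x).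
set L0 := \sum_i \sum_j a i j x * D2v i j x.
set b0 := \sum_i b i x * Dv i x.
set S := Num.sqrt (1 - eps) * _.
set L := second_order_op _ _ _ _ _ _ _.
move: (theta a x) th0 thTh => t th0 thTh HS.
have LE : L = L0 + b0 + c1 x * v x by [].
have hb : t * `|b0| <= Th * B * Num.sqrt d%:R * Num.sqrt (\sum_i Dv i x ^+ 2).
  rewrite -!mulrA; apply: ler_pM => //.
  apply: le_trans (ler_norm_sum _ _ _) _.
  apply: (@le_trans _ _ (\sum_i B * `|Dv i x|)).
    by apply: ler_sum => i _; rewrite normrM ler_wpM2r.
  rewrite -mulr_sumr.
  (* A positive trace has a non-zero diagonal entry, so some index [i] exists, and [B] dominates
     [|b i x|]. *)
  have B0 : 0 <= B.
    have [i _ _] : exists2 i : 'I_d, true & a i i x != 0.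
      move: T0; case: (pickP (fun i => a i i x != 0)) => [i ai|a0]; first by exists i.
      by rewrite big1 ?ltxx// => i _; move/negbFE/eqP: (a0 i).
    exact: le_trans (bB i).
  by apply: ler_wpM2l => //; exact: sum_norm_le_sqrt.
have hc : t * `|c1 x * v x| <= Th * C * `|v x|.
  by rewrite normrM -!mulrA ler_pM// ler_wpM2r.
have hL : t * `|L| <= Th * `|L| by rewrite ler_wpM2r.
set G := Num.sqrt (\sum_i Dv i x ^+ 2) in hb *.
have G0 : 0 <= G by exact: sqrtr_ge0.
have hmG : Th * B * Num.sqrt d%:R * G <=
    Num.max (Th * B * Num.sqrt d%:R) (Th * C) * G.
  by rewrite ler_wpM2r// le_max lexx.
have hmv : Th * C * `|v x| <= Num.max (Th * B * Num.sqrt d%:R) (Th * C) * `|v x|.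
  by rewrite ler_wpM2r// le_max lexx orbT.
have -> : laplacian D2v x = t * L - t * b0 - t * (c1 x * v x)
    - (t * L0 - laplacian D2v x) by rewrite LE; ring.
apply: le_trans (ler_normB _ _) _.
have h1 := ler_normB (t * L - t * b0) (t * (c1 x * v x)).
have h2 := ler_normB (t * L) (t * b0).
have ht (z : R) : `|t * z| = t * `|z| by rewrite normrM (ger0_norm th0).
rewrite !ht in h1 h2.
lra.
Qed.

End operator_bound.

(** * A priori bound in H^2 *)

Section operator_bound_exists.
Context {R : realType} {d : nat}.
Variable Om : set 'rV[R]_d.
Hypothesis mOm : measurable Om.

Local Notation mu := (lebesgue_row d : {measure set 'rV[R]_d -> \bar R}).

Lemma measurable_normf (v : 'rV[R]_d -> R) :
  measurable_fun Om v -> measurable_fun Om (fun x => `|v x|).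
Proof. by move=> mv; apply: measurableT_comp. Qed.

Lemma L2norm_norm (v : 'rV[R]_d -> R) :
  L2norm Om (fun x => `|v x|) = L2norm Om v.
Proof.
rewrite !L2normE//; congr (_ `^ _)%E.
by apply: eq_integral => x _; rewrite real_normK ?num_real.
Qed.

Lemma measurable_second_order_op a b c1 v Dv D2v :
  (forall i j, measurable_fun Om (a i j)) -> (forall i, measurable_fun Om (b i)) ->
  measurable_fun Om c1 -> measurable_fun Om v ->
  (forall i, measurable_fun Om (Dv i)) ->
  (forall i j, measurable_fun Om (D2v i j)) ->
  measurable_fun Om (second_order_op a b c1 v Dv D2v).
Proof.
move=> ma mb mc mv mD mD2; apply: measurable_funD; last exact: measurable_funM.
apply: measurable_funD.
  by apply: measurable_sum => i; apply: measurable_sum => j; exact: measurable_funM.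
by apply: measurable_sum => i; exact: measurable_funM.
Qed.

Lemma measurable_gradient_norm (Dv : 'I_d -> 'rV[R]_d -> R) :
  (forall i, measurable_fun Om (Dv i)) ->
  measurable_fun Om (fun x => Num.sqrt (\sum_i Dv i x ^+ 2)).
Proof.
move=> mD; apply: measurable_fun_sqrt => //.
by apply: measurable_sum => i; exact: measurable_funX.
Qed.

Lemma H2norm_ge0 v (Dv : 'I_d -> 'rV[R]_d -> R) D2v :
  (0 <= H2norm Om v Dv D2v)%E.
Proof.
rewrite /H2norm !adde_ge0 ?L2norm_ge0//.
by apply: sume_ge0 => i _; apply: sume_ge0 => j _; exact: L2norm_ge0.
Qed.

(** The Euclidean norm of the gradient is dominated by the sum of the [|Dv i|]. Finiteness is what
    permits absorbing a multiple of the H^2 norm into the left-hand side of the a priori bound. *)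
Lemma H2norm_lty v Dv D2v : H2_with Om v Dv D2v ->
  (H2norm Om v Dv D2v < +oo)%E.
Proof.
move=> [[mv v2] D2 DD2]; rewrite /H2norm !lte_add_pinfty//.
- have mD i : measurable_fun Om (Dv i) by have [[]] := D2 i.
  have mnD i := measurable_normf (mD i).
  apply: (@le_lt_trans _ _ (L2norm Om (fun x => \sum_i `|Dv i x|)%R)).
    apply: le_L2norm => //; first exact: measurable_gradient_norm.
      exact: measurable_sum.
    apply: nearW => x _; rewrite ger0_norm ?sqrtr_ge0// ger0_norm ?sumr_ge0//.
    exact: sqrt_sum_sqr_le.
  apply: le_lt_trans (L2norm_sum mOm _ mnD) _.
  apply: lte_sum_pinfty => i _; rewrite L2norm_norm.
  by have [[]] := D2 i.
- apply: lte_sum_pinfty => i _; apply: lte_sum_pinfty => j _.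
  by have [[]] := DD2 i j.
Qed.

(** Taking L^2 norms in the pointwise bound gives [A * N <= Th * |L v| + (s + K) * N] for the H^2
    norm [N]; since [A - s - K] is positive, the last term is absorbed on the left. *)
Lemma cordes_operator_bound (A eps : R) a b c1 :
  (2 <= d)%N -> 0 < A -> laplacian_bound Om A ->
  (forall i j, in_Linf Om (a i j)) -> (forall i, in_Linf Om (b i)) ->
  in_Linf Om c1 -> elliptic Om a -> 0 < eps <= 1 -> cordes Om a eps ->
  0 < 1 - Num.sqrt (1 - eps) / A - Cm Om a b c1 / A ->
  exists2 A2 : R, 0 < A2 & operator_bound Om a b c1 A2.
Proof.
move=> d2 A0 Abound aoo boo coo ell /andP[e0 e1] cord small.
have [M M0 thM] := elliptic_theta (ltnW d2) ell.
have thoo : (Linfnorm Om (theta a) < +oo)%E.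
  apply: le_lt_trans (ltry M); apply: Linfnorm_le; first exact: ltW.
  by move=> x /thM[_ _ /andP[t0 tM]]; rewrite ger0_norm.
set Th := fine (Linfnorm Om (theta a)).
have Th0 : 0 <= Th by apply: fine_ge0; exact: Lnorm_ge0.
set B := \big[Num.max/0]_i fine (Linfnorm Om (b i)).
set C := fine (Linfnorm Om c1).
have C0 : 0 <= C by apply: fine_ge0; exact: Lnorm_ge0.
set K := Cm Om a b c1.
have KE : K = Num.max (Th * B * Num.sqrt d%:R) (Th * C) by [].
have K0 : 0 <= K by rewrite KE le_max (mulr_ge0 Th0 C0) orbT.
set s := Num.sqrt (1 - eps).
have s0 : 0 <= s by exact: sqrtr_ge0.
set k := A - s - K.
(* The smallness hypothesis multiplied by [A]. *)
have k0 : 0 < k.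
  have -> : k = A * (1 - s / A - K / A) by rewrite /k; field; rewrite gt_eqF.
  by rewrite mulr_gt0.
(* [Th] is only known to be non-negative; adding 1 keeps the denominator positive. *)
exists (k / (Th + 1)); first by rewrite divr_gt0// ltr_wpDl.
move=> v Dv D2v vH2 v10.
have [[mv _] HD HD2] := vH2.
have mD i : measurable_fun Om (Dv i) by have [[]] := HD i.
have mD2 i j : measurable_fun Om (D2v i j) by have [[]] := HD2 i j.
have ma i j : measurable_fun Om (a i j) by have [] := aoo i j.
have mb i : measurable_fun Om (b i) by have [] := boo i.
have mc : measurable_fun Om c1 by have [] := coo.
set N := H2norm Om v Dv D2v.
have Nfin : N \is a fin_num by rewrite ge0_fin_numE ?H2norm_ge0 ?H2norm_lty.
set L := second_order_op a b c1 v Dv D2v.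
have mL : measurable_fun Om L by exact: measurable_second_order_op.
set G := fun x => Num.sqrt (\sum_i Dv i x ^+ 2).
have mG : measurable_fun Om G by exact: measurable_gradient_norm.
have mnL := measurable_normf mL.
have mnv := measurable_normf mv.
have mnD2 i j := measurable_normf (mD2 i j).
have mS : measurable_fun Om (fun x => \sum_i \sum_j `|D2v i j x|).
  by apply: measurable_sum => i; exact: measurable_sum.
have mcst (r : R) : measurable_fun Om (fun=> r) by exact: measurable_cst.
have key : (L2norm Om (laplacian D2v) <= Th%:E * L2norm Om L + (s + K)%:E * N)%E.
  apply: (@le_trans _ _ (L2norm Om (fun x => Th * `|L x|
      + s * (\sum_i \sum_j `|D2v i j x|) + K * (G x + `|v x|))%R)).
    apply: le_L2norm => //.
    - by apply: measurable_sum => i.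
    - apply: measurable_funD; last first.
        by apply: measurable_funM => //; exact: measurable_funD.
      by apply: measurable_funD; exact: measurable_funM.
    have cae := ae_Linfnorm coo.2.
    (* Finitely many exceptional null sets are merged, so that one bound holds for all components of
       [b] at once. *)
    have bae : {ae mu, forall x, forall i, Om x ->
        `|b i x| <= fine (Linfnorm Om (b i))}.
      by apply: filter_forall => i; apply: ae_Linfnorm; exact: (boo i).2.
    have tae := ae_Linfnorm thoo.
    near=> x => Omx.
    have [T0 N0 /andP[t0 _]] := thM x Omx.
    rewrite [leRHS]ger0_norm; last first.
      by rewrite !addr_ge0 ?mulr_ge0// ?sqrtr_ge0// ?addr_ge0 ?sqrtr_ge0//;
        apply: sumr_ge0 => i _; exact: sumr_ge0.
    rewrite KE; apply: cordes_pointwise => //.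
    - by rewrite ltr_wpDl// subr_ge0 ler1n ltnW.
    - by move: Omx; near: x.
    - rewrite t0 (le_trans (ler_norm _))//.
      by move: Omx; near: x.
    - move=> i; apply: le_trans (le_bigmax _ _ i).
      by move: i Omx; near: x; apply: filterS bae => x bx i /(bx i).
    - by move: Omx; near: x.
  have mTL : measurable_fun Om (fun x => Th * `|L x|) by exact: measurable_funM.
  have msS : measurable_fun Om (fun x => s * (\sum_i \sum_j `|D2v i j x|)).
    exact: measurable_funM.
  have mGv : measurable_fun Om (fun x => G x + `|v x|) by exact: measurable_funD.
  apply: le_trans (L2normD mOm (measurable_funD mTL msS) _) _.
    exact: measurable_funM.
  apply: le_trans (leeD (L2normD mOm mTL msS) (lexx _)) _.
  rewrite !L2normZ// (ger0_norm Th0) (ger0_norm s0) (ger0_norm K0) L2norm_norm.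
  rewrite -addeA leeD2l// EFinD ge0_muleDl ?lee_fin//.
  (* The [K] term only sees the lower order part of [N] and the [s] term only the Hessian part;
     bounding each by all of [N] yields [(s + K) * N]. *)
  have HN : (L2norm Om G + L2norm Om v <= N)%E.
    rewrite /N /H2norm [leLHS]addeC leeDl//.
    by apply: sume_ge0 => i _; apply: sume_ge0 => j _; exact: L2norm_ge0.
  have HS : (\sum_i \sum_j L2norm Om (D2v i j) <= N)%E.
    by rewrite /N /H2norm leeDr// adde_ge0 ?L2norm_ge0.
  apply: leeD; apply: lee_wpmul2l; rewrite ?lee_fin//.
    apply: le_trans HS; apply: le_trans (L2norm_sum mOm _ _) _.
      by move=> i; exact: measurable_sum.
    apply: lee_sum => i _; apply: le_trans (L2norm_sum mOm _ _) _ => //.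
    by apply: lee_sum => j _; rewrite L2norm_norm.
  apply: le_trans HN; apply: le_trans (L2normD mOm mG mnv) _.
  by rewrite L2norm_norm.
have := le_trans (Abound _ _ _ vH2 v10) key.
rewrite -/N -(fineK Nfin); set n := fine N.
have : (0 <= L2norm Om L)%E by exact: L2norm_ge0.
(* If the norm of [L] is infinite there is nothing to prove; otherwise the inequality is between
   reals. *)
case: (L2norm Om L) => [l| |]//.
- rewrite -!EFinM -EFinD !lee_fin => l0 h.
  rewrite mulrAC ler_pdivrMr ?ltr_wpDl//.
  have -> : k * n = A * n - (s + K) * n by rewrite /k; ring.
  by rewrite mulrDr mulr1 mulrC; lra.
- by move=> *; rewrite leey.
Unshelve. all: by end_near. Qed.

End operator_bound_exists.

(** * Integration by parts *)

Section divergence.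
Context {R : realType}.

(** The fundamental theorem of calculus on an interval at whose ends [F] vanishes. *)
Lemma integral_derivative_compact_support (f F : R -> R) (N : R) :
  continuous f -> (forall t : R, is_derive t 1 F (f t)) ->
  (forall t, N < `|t| -> F t = 0 /\ f t = 0) ->
  (\int[lebesgue_measure]_t (f t)%:E = 0)%E.
Proof.
move=> cf dF F0.
(* Positive whatever the sign of [N], and strictly beyond [N], so that both ends lie where [F] is
   0. *)
pose M : R := `|N| + 1.
have M0 : 0 < M by rewrite ltr_wpDl.
have NM (t : R) : M <= `|t| -> N < `|t|.
  by apply: lt_le_trans; rewrite (le_lt_trans (ler_norm N))// ltrDl.
have cF : continuous F.
  move=> t; apply: differentiable_continuous; apply/derivable1_diffP.
  exact: (@ex_derive _ _ _ _ _ _ _ (dF t)).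
have -> : (\int[lebesgue_measure]_t (f t)%:E =
    \int[lebesgue_measure]_(t in `[(- M)%R, M]) (f t)%:E)%E.
  rewrite [RHS]integral_mkcond; apply: eq_integral => t _.
  rewrite patchE; case: ifPn => //; rewrite notin_setE/= in_itv/= -ler_norml.
  by move/negP; rewrite -ltNge => /ltW/NM/F0[_ ->].
rewrite (@continuous_FTC2 _ f F)//.
- have [-> _] := F0 M (NM M (ler_norm M)).
  by have [|-> _] := F0 (- M); [apply: NM; rewrite normrN ler_norm|rewrite subee].
- by rewrite (lt_trans _ M0)// oppr_lt0.
- exact: continuous_subspaceT.
- split.
  + by move=> t _; exact: (@ex_derive _ _ _ _ _ _ _ (dF t)).
  + by apply: cvg_at_right_filter; exact: cF.
  + by apply: cvg_at_left_filter; exact: cF.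
- by move=> t _; rewrite derive1E; exact: (@derive_val _ _ _ _ _ _ _ (dF t)).
Qed.

Lemma bounded_support_integrable dd (T : measurableType dd)
    (m : {measure set T -> \bar R}) (D : set T) (f : T -> R) (M : R) :
  measurable D -> (m D < +oo)%E -> measurable_fun setT f ->
  (forall x, `|f x| <= M) -> (forall x, ~ D x -> f x = 0) ->
  m.-integrable setT (EFin \o f).
Proof.
move=> mD mDoo mf fM f0.
have -> : EFin \o f = (EFin \o f) \_ D.
  apply/funext => x; rewrite patchE; case: ifPn => //.
  by rewrite notin_setE/= => /f0 ->.
apply/(integrable_mkcond _ mD).
apply: measurable_bounded_integrable => //.
  exact: measurable_funTS.
exists M; split => [|y My x _]; first exact: num_real.
exact: le_trans (fM x) (ltW My).
Qed.

Lemma row_cons_line0 n t (y : 'rV[R]_n) :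
  row_cons (t, y) = row_cons (0, y) + t *: delta_mx ord0 ord0.
Proof.
apply/rowP => j; rewrite !mxE eqxx/=; case: (unliftP ord0 j) => [k|] ->.
  by rewrite ?mulr0 ?addr0 //= mulr0 addr0.
by rewrite eqxx mulr1 add0r.
Qed.

Lemma row_cons_lineS n t s (y : 'rV[R]_n) (j : 'I_n) :
  row_cons (t, y + s *: delta_mx ord0 j) =
  row_cons (t, y) + s *: delta_mx ord0 (lift ord0 j).
Proof.
apply/rowP => k; rewrite !mxE eqxx/=; case: (unliftP ord0 k) => [l|] -> /=.
  by rewrite !mxE eqxx/= (inj_eq lift_inj).
by rewrite mulr0 addr0.
Qed.

(** Fubini by induction on the dimension. Boundedness and support in a box give the integrability
    over the product that permits choosing the order of integration. *)
Lemma integral_row_eq0 n (G : 'rV[R]_n -> R) (N M : R) (i : 'I_n) :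
  measurable_fun setT G -> (forall x, `|G x| <= M) ->
  (forall x : 'rV[R]_n, ~ (forall j, `|x ord0 j| <= N) -> G x = 0) ->
  (forall x, \int[lebesgue_measure]_t (G (x + t *: delta_mx ord0 i)%R)%:E = 0)%E ->
  (\int[lebesgue_row n]_x (G x)%:E = 0)%E.
Proof.
elim: n G i => [|n IHn] G i mG GM G0 line; first by case: i {line}.
have mGc : measurable_fun setT (G \o @row_cons R n).
  by apply: measurableT_comp => //; exact: measurable_row_cons.
have iG : ((@lebesgue_measure R) \x (lebesgue_row n))%E.-integrable setT
    (EFin \o (G \o @row_cons R n)).
  apply: (@bounded_support_integrable _ _ _
    (@row_cons R n @^-1` [set x : 'rV[R]_n.+1 | forall j, `|x ord0 j| <= N]) _ M) => //.
  - rewrite -[X in measurable X]setTI; apply: measurable_row_cons => //.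
    exact: measurable_row_box.
  - exact: (lebesgue_row_box_lty n.+1 N).
  - by move=> x; exact: GM.
  - by move=> x; exact: G0.
transitivity (\int[(@lebesgue_measure R) \x (lebesgue_row n)]_z
    (EFin \o (G \o @row_cons R n)) z)%E.
  rewrite /= /row_prod integral_pushforward//.
  - exact: measurable_row_cons.
  - exact/measurable_EFinP.
case: (unliftP ord0 i) line => [j|] -> line.
  (* Direction other than the first: with the first coordinate frozen, the slice has integral 0 by
     induction. *)
  rewrite -integral12_prod_meas1//; apply: integral0_eq => t _.
  rewrite /fubini_F; apply: (IHn (fun y => G (row_cons (t, y))) j).
  - apply: (measurableT_comp mGc); exact: pair1_measurable.
  - by move=> y; exact: GM.
  - move=> y Hy; apply: G0 => H; apply: Hy => k.
    by have := H (lift ord0 k); rewrite row_consS.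
  - by move=> y; under eq_integral do rewrite row_cons_lineS.
(* First direction: the inner integral runs along the given line and vanishes by hypothesis. *)
rewrite -integral21_prod_meas1//; apply: integral0_eq => y _.
rewrite /fubini_G; under eq_integral do rewrite /= row_cons_line0.
exact: line.
Qed.

End divergence.

(** * Classical derivatives as weak derivatives *)

Section integration_by_parts.
Context {R : realType} {d : nat}.
Implicit Types (Om K : set 'rV[R]_d) (s phi h : 'rV[R]_d -> R).

Local Notation mu := (lebesgue_row d : {measure set 'rV[R]_d -> \bar R}).

Lemma compact_row_box K : compact K ->
  exists N : R, forall x, K x -> forall j, `|x ord0 j| <= N.
Proof.
move=> /compact_bounded[M [_ HM]]; exists (M + 1) => x Kx j.
apply: le_trans (HM (M + 1) _ x Kx); last by rewrite ltrDl.
exact: row_coord_le_norm.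
Qed.

Lemma compact_support_bounded K h : compact K -> continuous h ->
  (forall x, ~ K x -> h x = 0) -> exists M : R, forall x, `|h x| <= M.
Proof.
move=> cK ch h0.
have /compact_bounded[M [_ HM]] := continuous_compact (continuous_subspaceT ch) cK.
exists (`|M| + 1) => x; have [Kx|/h0 ->] := pselect (K x).
  apply: (HM (`|M| + 1)); last by exists x.
  by rewrite (le_lt_trans (ler_norm M))// ltrDl.
by rewrite normr0 addr_ge0.
Qed.

Lemma continuous_measurable_row h : continuous h -> measurable_fun setT h.
Proof.
move=> ch; apply: open_continuous_measurable_fun_row => [|x _]; first exact: openT.
exact: ch.
Qed.

Lemma compact_support_integrable K h : compact K -> continuous h ->
  (forall x, ~ K x -> h x = 0) -> mu.-integrable setT (EFin \o h).
Proof.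
move=> cK ch h0; have [M hM] := compact_support_bounded cK ch h0.
have [N KN] := compact_row_box cK.
apply: (@bounded_support_integrable _ _ _ _
  [set x : 'rV[R]_d | forall j, `|x ord0 j| <= N] _ M).
- exact: measurable_row_box.
- exact: lebesgue_row_box_lty.
- exact: continuous_measurable_row.
- exact: hM.
- by move=> x Hx; apply: h0 => /KN.
Qed.

Lemma near_support0 K h x : compact K -> (forall x, ~ K x -> h x = 0) ->
  ~ K x -> \forall y \near x, h y = 0.
Proof.
move=> cK h0 Kx; have oK : open (~` K).
  by apply: closed_openC; apply: compact_closed => //; exact: Rhausdorff.
by apply: filterS (open_nbhs_nbhs (conj oK Kx)) => y /h0.
Qed.

(** [s] may be discontinuous outside [Om], but off [K] the factor [h] vanishes in a whole
    neighbourhood, and so does the product. *)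
Lemma continuous_mul_support Om K s h : compact K -> K `<=` Om ->
  (forall x, Om x -> {for x, continuous s}) -> continuous h ->
  (forall x, ~ K x -> h x = 0) -> continuous (fun x => s x * h x).
Proof.
move=> cK KOm cs ch h0 x; have [Kx|Kx] := pselect (K x).
  by apply: (@continuousM _ _ s h); [exact/cs/KOm|exact: ch].
have sh0 := near_support0 cK h0 Kx.
have e0 : {near x, (fun=> 0) =1 (fun x => s x * h x)}.
  by apply: filterS sh0 => y ->; rewrite mulr0.
rewrite /continuous_at (h0 x Kx) mulr0; apply: cvg_trans (near_eq_cvg e0) _.
exact: cvg_cst.
Qed.

Lemma partial_support0 K phi i x : compact K -> (forall x, ~ K x -> phi x = 0) ->
  ~ K x -> partial i phi x = 0.
Proof.
move=> cK phi0 Kx.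
rewrite /partial (@near_eq_derive _ _ _ phi (cst 0)) ?derive_cst//.
exact: near_support0 cK phi0 Kx.
Qed.

(** Both derivatives are limits of the same difference quotient. *)
Lemma is_derive_line (F : 'rV[R]_d -> R) x v (t l : R) :
  is_derive (x + t *: v) v F l -> is_derive t 1 (fun u : R => F (x + u *: v)) l.
Proof.
move=> [dF DF].
have E : (fun h : R => h^-1 *: (((fun u => F (x + u *: v)) \o shift t) (h *: 1)
             - F (x + t *: v))) =
         (fun h : R => h^-1 *: ((F \o shift (x + t *: v)) (h *: v) - F (x + t *: v))).
  apply/funext => h /=; congr (_ *: (F _ - _)).
  by rewrite [h *: 1]mulr1 scalerDl addrCA.
split; first by rewrite /derivable E.
by rewrite -DF /derive E.
Qed.

(** The sum [h1 + h2] is the [i]-th partial derivative of the compactly supported product of [s] and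
    [phi]. Its integral along every line in direction [i] is 0, hence so is its integral over the
    space, which is integration by parts. *)
Lemma weak_partial_C1 Om i s : open Om ->
  (forall x, Om x -> {for x, continuous s}) ->
  (forall x, Om x -> derivable s x (delta_mx ord0 i)) ->
  (forall x, Om x -> {for x, continuous (partial i s)}) ->
  weak_partial Om i s (partial i s).
Proof.
move=> oOm cs ds cDs phi [Cphi [K [cK KOm phi0]]].
have [cphi /(_ i)[dphi [cDphi _]]] := Cphi 1%N.
have {}cphi : continuous phi by move=> x; exact: cphi.
have {}cDphi : continuous (partial i phi) by move=> x; exact: cDphi.
have Dphi0 x : ~ K x -> partial i phi x = 0 by exact: partial_support0.
have c1 := continuous_mul_support cK KOm cs cDphi Dphi0.
have c2 := continuous_mul_support cK KOm cDs cphi phi0.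
set h1 := fun x => s x * partial i phi x in c1 *.
set h2 := fun x => partial i s x * phi x in c2 *.
have h10 x : ~ K x -> h1 x = 0 by move=> /Dphi0; rewrite /h1 => ->; rewrite mulr0.
have h20 x : ~ K x -> h2 x = 0 by move=> /phi0; rewrite /h2 => ->; rewrite mulr0.
have i1 := compact_support_integrable cK c1 h10.
have i2 := compact_support_integrable cK c2 h20.
(* The integrands vanish off [K], which lies in [Om], so integrals over [Om] become integrals over
   the whole space. *)
have restr h : (forall x, ~ K x -> h x = 0) ->
    \int[mu]_(x in Om) h x = \int[mu]_x h x.
  move=> h0; rewrite Rintegral_mkcond; congr (Rintegral _ _ _).
  apply/funext => x; rewrite patchE; case: ifPn => //.
  by rewrite notin_setE => nOm; rewrite h0// => /KOm.
rewrite !restr//; apply/eqP; rewrite -addr_eq0 -RintegralD//.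
have iG := integrableD measurableT i1 i2.
have cG : continuous (fun x => h1 x + h2 x).
  by move=> x; exact: (cvgD (c1 x) (c2 x)).
have [M GM] : exists M : R, forall x, `|h1 x + h2 x| <= M.
  apply: (compact_support_bounded cK cG).
  by move=> x Kx; rewrite h10// h20// addr0.
have [N KN] := compact_row_box cK.
rewrite /Rintegral (@integral_row_eq0 _ _ (fun x => h1 x + h2 x) N M i)//.
- exact: continuous_measurable_row.
- move=> x Hx; have Kx : ~ K x by move=> /KN.
  by rewrite h10// h20// addr0.
move=> x; pose e : 'rV[R]_d := delta_mx ord0 i.
(* Once [|t|] exceeds [N + |x_i|], the [i]-th coordinate of [x + t *: e] exceeds [N] in absolute
   value and the point has left [K]. *)
apply: (@integral_derivative_compact_support _ _
  (fun t => s (x + t *: e) * phi (x + t *: e)) (N + `|x ord0 i|)).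
- move=> t; apply: (@continuous_comp _ _ _ (fun t : R => x + t *: e)
    (fun x => h1 x + h2 x)); last exact: cG.
  by apply: cvgD; [exact: cvg_cst|apply: cvgZr_tmp; exact: cvg_id].
- move=> t; apply: (@is_derive_line (fun x => s x * phi x)).
  (* On [K] the product rule applies; off [K] the product is locally 0, even where [s] has no
     derivative. *)
  set y := x + t *: e; have [Ky|Ky] := pselect (K y).
    have -> : h1 y + h2 y = s y *: 'D_e phi y + phi y *: 'D_e s y.
      by rewrite /h1 /h2 /partial -/e [in RHS]/GRing.scale/= [X in _ = _ + X]mulrC.
    have dsy : derivable s y e by apply: ds; exact: KOm.
    have dpy : derivable phi y e by exact: dphi.
    apply: DeriveDef; first exact: (derivableM dsy dpy).
    exact: (deriveM dsy dpy).
  rewrite h10// h20// addr0.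
  apply: (@near_eq_is_derive _ _ _ (cst 0)).
  by apply: filterS (near_support0 cK phi0 Ky) => z ->; rewrite mulr0.
- move=> t Nt; have Kt : ~ K (x + t *: e).
    move=> /KN/(_ i); rewrite !mxE !eqxx mulr1; apply/negP; rewrite -ltNge.
    rewrite -ltrBrDr in Nt; apply: lt_le_trans Nt _.
    by rewrite -[t in leLHS](addrK (x ord0 i)) [t + _]addrC lerBlDr ler_normB.
  by rewrite phi0// mulr0 h10// h20// addr0.
Qed.

End integration_by_parts.

(** * Regularity of splines *)

Section Ck_ring.
Context {R : realType} {d : nat}.
Implicit Types (p q : 'rV[R]_d -> R).

Local Notation Ck := (Ck [set: 'rV[R]_d]).

Lemma CkW k p : Ck k.+1 p -> Ck k p.
Proof.
elim: k p => [|k IHk] p [cp Hp]; first by split.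
by split=> // i; have [dp Hk] := Hp i; split=> //; exact: IHk.
Qed.

Lemma Ck_cst k (c : R) : Ck k (fun=> c).
Proof.
elim: k c => [|k IHk] c; first by split=> // x _; exact: cst_continuous.
split=> [x _|i]; first exact: cst_continuous.
split=> [x _|]; first exact: (@derivable_cst _ _ _ c).
by rewrite (_ : partial i _ = fun=> 0)//; apply/funext => x; exact: (@derive_cst _ _ _ c).
Qed.

Lemma Ck_coord k j : Ck k (fun x => x ord0 j).
Proof.
have cj x : {for x, continuous (fun y : 'rV[R]_d => y ord0 j)}.
  exact: coord_continuous.
case: k => [|k]; first by split=> // x _.
split=> [x _|i]; first exact: cj.
have H x : is_derive x (delta_mx ord0 i) (fun y : 'rV[R]_d => y ord0 j)
    ((delta_mx ord0 i : 'rV[R]_d) ord0 j).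
  pose c : R := (delta_mx ord0 i : 'rV[R]_d) ord0 j.
  pose F (h : R) : R := h^-1 *: (((fun y : 'rV[R]_d => y ord0 j) \o shift x)
    (h *: delta_mx ord0 i) - x ord0 j).
  (* The difference quotient of a coordinate function takes the same value for every non-zero
     [h]. *)
  have e0 : {near (0 : R)^', (fun=> c) =1 F}.
    near=> h; rewrite /F /= !mxE addrK [RHS]mulrA mulVf ?mul1r /c ?mxE//.
    by near: h; exact: nbhs_dnbhs_neq.
  have E : F @ (0 : R)^' --> c.
    by apply: cvg_trans (near_eq_cvg e0) _; exact: cvg_cst.
  by split; [exact: (cvgP _ E)|exact: (cvg_lim (@Rhausdorff R) E)].
split=> [x _|]; first exact: ex_derive.
rewrite (_ : partial i _ = fun=> (delta_mx ord0 i : 'rV[R]_d) ord0 j).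
  exact: Ck_cst.
by apply/funext => x; exact: derive_val.
Unshelve. all: by end_near. Qed.

Lemma CkD k p q : Ck k p -> Ck k q -> Ck k (fun x => p x + q x).
Proof.
elim: k p q => [|k IHk] p q [cp Hp] [cq Hq].
  by split=> // x _; apply: (@continuousD _ _ _ p q); [exact: cp|exact: cq].
split=> [x _|i]; first by apply: (@continuousD _ _ _ p q); [exact: cp|exact: cq].
have [dp kp] := Hp i; have [dq kq] := Hq i.
split=> [x _|]; first by apply: derivableD; [exact: dp|exact: dq].
rewrite (_ : partial i _ = fun x => partial i p x + partial i q x); first exact: IHk.
by apply/funext => x; apply: deriveD; [exact: dp|exact: dq].
Qed.

Lemma CkM k p q : Ck k p -> Ck k q -> Ck k (fun x => p x * q x).
Proof.
elim: k p q => [|k IHk] p q kp0 kq0; have [cp Hp] := kp0; have [cq Hq] := kq0.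
  by split=> // x _; apply: (@continuousM _ _ p q); [exact: cp|exact: cq].
split=> [x _|i]; first by apply: (@continuousM _ _ p q); [exact: cp|exact: cq].
have [dp kp] := Hp i; have [dq kq] := Hq i.
split=> [x _|]; first by apply: derivableM; [exact: dp|exact: dq].
rewrite (_ : partial i _ = fun x => p x * partial i q x + q x * partial i p x).
  (* The product rule retains the undifferentiated factors; [CkW] lowers them to the class required
     by the induction hypothesis. *)
  by apply: CkD; apply: IHk => //; exact: CkW.
by apply/funext => x; apply: deriveM; [exact: dp|exact: dq].
Qed.

Lemma Ck_sum k (I : Type) (r : seq I) (p : I -> 'rV[R]_d -> R) :
  (forall i, Ck k (p i)) -> Ck k (fun x => \sum_(i <- r) p i x).
Proof.
move=> kp; elim: r => [|i r IHr].
  by under eq_fun do rewrite big_nil; exact: Ck_cst.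
by under eq_fun do rewrite big_cons; exact: CkD.
Qed.

Lemma Ck_prod k (I : Type) (r : seq I) (p : I -> 'rV[R]_d -> R) :
  (forall i, Ck k (p i)) -> Ck k (fun x => \prod_(i <- r) p i x).
Proof.
move=> kp; elim: r => [|i r IHr].
  by under eq_fun do rewrite big_nil; exact: Ck_cst.
by under eq_fun do rewrite big_cons; exact: CkM.
Qed.

Lemma CkX k p n : Ck k p -> Ck k (fun x => p x ^+ n).
Proof.
move=> kp; elim: n => [|n IHn].
  by under eq_fun do rewrite expr0; exact: Ck_cst.
by under eq_fun do rewrite exprS; exact: CkM.
Qed.

(** Barycentric coordinates are linear forms in [(1, x)], so a piece is a polynomial on the whole
    space. *)
Lemma Ck_piece m D (V : 'I_m -> simplex) (cs : coefs d m D) T k :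
  Ck k (piece V cs T).
Proof.
apply: Ck_sum => a; apply: CkM; first exact: Ck_cst.
apply: CkM; first exact: Ck_cst.
apply: Ck_prod => j; apply: CkX.
under eq_fun do rewrite mxE; apply: Ck_sum => l.
apply: CkM; last exact: Ck_cst.
case: (split_ordP l) => l' ->.
  by under eq_fun do rewrite row_mxEl; exact: Ck_cst.
by under eq_fun do rewrite row_mxEr; exact: Ck_coord.
Qed.

End Ck_ring.

(** * Functions agreeing pointwise with one of finitely many pieces *)

Section piecewise.
Context {R : realType} {d : nat}.
Variable Om : set 'rV[R]_d.

(* If at [x] the value or the derivative of [g] differs from that of every
   [p T], then on the punctured line through [x] all the [p T] eventually differ
   from [g]. *)
Lemma piecewise_derive (I : finType) (p : I -> 'rV[R]_d -> R) g e :
  open Om ->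
  (forall T, continuous (p T)) -> (forall T x, derivable (p T) x e) ->
  (forall x, Om x -> {for x, continuous g}) ->
  (forall x, Om x -> derivable g x e) ->
  (forall x, Om x -> exists T, g x = p T x) ->
  forall x, Om x -> exists T, 'D_e g x = 'D_e (p T) x.
Proof.
move=> oOm cp dp cg dg gp x Omx; apply: contrapT => nT.
have line (y : 'rV[R]_d) : ((h *: e + y) @[h --> (0 : R)^']) --> y.
  rewrite -[X in _ --> X]add0r -[X in _ --> X + _](scale0r e).
  apply: cvg_within_filter.
  by apply: cvgD; [apply: cvgZr_tmp; exact: cvg_id|exact: cvg_cst].
have neq T : \forall h \near (0 : R)^', g (h *: e + x) != p T (h *: e + x).
  have [gx|gx] := eqVneq (g x) (p T x); last first.
    have : (g (h *: e + x) - p T (h *: e + x)) @[h --> (0 : R)^'] --> g x - p T x.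
      apply: cvgB; first exact: (cvg_comp _ _ (line x) (cg x Omx)).
      exact: (cvg_comp _ _ (line x) (cp T x)).
    move=> /cvgr_neq0; rewrite subr_eq0 => /(_ gx).
    by apply: filterS => h; rewrite subr_eq0.
  have Dx : 'D_e g x != 'D_e (p T) x by apply/eqP => Dx; apply: nT; exists T.
  have : (h^-1 *: (g (h *: e + x) - g x) - h^-1 *: (p T (h *: e + x) - p T x))
      @[h --> (0 : R)^'] --> 'D_e g x - 'D_e (p T) x.
    by apply: cvgB; [exact: dg|exact: dp].
  move=> /cvgr_neq0; rewrite subr_eq0 => /(_ Dx).
  apply: filterS => h; apply: contra => /eqP ->.
  by rewrite gx subrr.
have Omnear : \forall h \near (0 : R)^', Om (h *: e + x).
  by apply: line; exact: open_nbhs_nbhs.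
(* Finiteness of [I] lets one punctured neighbourhood serve all pieces; any point of it contradicts
   [gp]. *)
have neqs : \forall h \near (0 : R)^', forall T,
    g (h *: e + x) != p T (h *: e + x) by apply: filter_forall.
have both : \forall h \near (0 : R)^', Om (h *: e + x) /\
    forall T, g (h *: e + x) != p T (h *: e + x) by apply: filterI.
have := @filter_ex _ _ _ _ both.
by move=> [h [/gp[T gT] /(_ T)]]; rewrite gT eqxx.
Qed.

(** Each piece is continuous, hence bounded on a compact box containing [Om]; the largest of these
    finitely many bounds serves for [g]. *)
Lemma piecewise_bounded (I : finType) (p : I -> 'rV[R]_d -> R) g :
  bounded_set Om -> (forall T, continuous (p T)) ->
  (forall x, Om x -> exists T, g x = p T x) ->
  exists M : R, forall x, Om x -> `|g x| <= M.
Proof.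
move=> [N [_ HN]] cp gp.
pose K := [set x : 'rV[R]_d | forall i, `[- (N + 1), N + 1]%classic (x ord0 i)].
have cK : compact K.
  apply: (@rV_compact R d (fun=> `[- (N + 1), N + 1]%classic)) => i.
  exact: segment_compact.
have OmK x : Om x -> K x.
  move=> Omx i /=; rewrite in_itv/= -ler_norml.
  apply: le_trans (HN (N + 1) _ x Omx); last by rewrite ltrDl.
  exact: row_coord_le_norm.
have H T : exists M : R, forall x, Om x -> `|p T x| <= M.
  have /compact_bounded[M [_ HM]] := continuous_compact (continuous_subspaceT (cp T)) cK.
  exists (M + 1) => x Omx; apply: (HM (M + 1)); first by rewrite ltrDl.
  by exists x => //; exact: OmK.
have [M HM] := choice H.
exists (\big[Num.max/0]_T M T) => x Omx; have [T ->] := gp x Omx.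
exact: le_trans (HM T x Omx) (le_bigmax _ _ T).
Qed.

(** [piecewise_derive] is applied twice, first to the spline and then to its first derivatives, and
    each level is bounded by [piecewise_bounded]. *)
Lemma smooth_spline_bounded m D (V : 'I_m -> simplex) (cs : coefs d m D) r :
  open Om -> bounded_set Om -> (2 <= r)%N -> smooth_spline V Om r cs ->
  [/\ exists M : R, forall x, Om x -> `|spline V cs x| <= M,
      forall i, exists M : R, forall x, Om x -> `|partial i (spline V cs) x| <= M &
      forall i j, exists M : R,
        forall x, Om x -> `|partial j (partial i (spline V cs)) x| <= M].
Proof.
case: r => [|[|r]]// oOm bOm _ [cs0 H1].
(* [None] stands for the default value 0 that [spline] takes at points outside all simplices. *)
pose p (o : option 'I_m) := if o is Some T then piece V cs T else fun=> 0.
have kp k o : Ck setT k (p o).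
  by case: o => [T|]; [exact: Ck_piece|exact: Ck_cst].
have c0 o : continuous (p o) by move=> x; exact: (kp 0%N o).1.
have d0 o i x : derivable (p o) x (delta_mx ord0 i) by exact: ((kp 1%N o).2 i).1.
have c1 i o : continuous (partial i (p o)).
  by move=> x; exact: ((kp 1%N o).2 i).2.1.
have d1 i o j x : derivable (partial i (p o)) x (delta_mx ord0 j).
  exact: (((kp 2%N o).2 i).2.2 j).1.
have c2 i j o : continuous (partial j (partial i (p o))).
  by move=> x; exact: (((kp 2%N o).2 i).2.2 j).2.1.
have s0 x : Om x -> exists o, spline V cs x = p o x.
  move=> _; rewrite /spline; case: pickP => [T _|_]; first by exists (Some T).
  by exists None.
have s1 i x : Om x -> exists o, partial i (spline V cs) x = partial i (p o) x.
  exact: (piecewise_derive oOm c0 (fun o => d0 o i) cs0 (H1 i).1 s0).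
have s2 i j x : Om x -> exists o,
    partial j (partial i (spline V cs)) x = partial j (partial i (p o)) x.
  have [_ [cs1 H2]] := H1 i.
  exact: (piecewise_derive oOm (c1 i) (fun o => d1 i o j) cs1 (H2 j).1 (s1 i)).
split.
- exact: (piecewise_bounded bOm c0 s0).
- by move=> i; exact: (piecewise_bounded bOm (c1 i) (s1 i)).
- by move=> i j; exact: (piecewise_bounded bOm (c2 i j) (s2 i j)).
Qed.

End piecewise.

(** * Proof of the estimate *)

Lemma Ck_continuous (R : realType) d (Om : set 'rV[R]_d) k v :
  Ck Om k v -> forall x, Om x -> {for x, continuous v}.
Proof. by case: k => [|k] []. Qed.

Section H2_subtraction.
Context {R : realType} {d : nat}.
Variable Om : set 'rV[R]_d.
Hypotheses (oOm : open Om) (bOm : bounded_set Om).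

Local Notation mu := (lebesgue_row d : {measure set 'rV[R]_d -> \bar R}).

Let mOm : measurable Om := open_measurable_row oOm.
Let Om_fin : (mu Om < +oo)%E := bounded_lebesgue_row_lty mOm bOm.

Lemma in_L2_integrable_test v K h : in_L2 Om v -> compact K -> continuous h ->
  (forall x, ~ K x -> h x = 0) ->
  mu.-integrable Om (EFin \o (fun x => v x * h x)).
Proof.
move=> v2 cK ch h0; have [M hM] := compact_support_bounded cK ch h0.
apply: (in_L2_integrableM mOm Om_fin v2 (M := M)) => //.
by apply: measurable_funTS; exact: continuous_measurable_row.
Qed.

(** Splitting the integrals requires each product to be integrable: L^2 functions on the bounded set
    [Om] are, and remain so after multiplication by bounded test functions and their derivatives. *)
Lemma weak_partialB i v w v' w' :
  in_L2 Om v -> in_L2 Om w -> in_L2 Om v' -> in_L2 Om w' ->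
  weak_partial Om i v v' -> weak_partial Om i w w' ->
  weak_partial Om i (fun x => v x - w x) (fun x => v' x - w' x).
Proof.
move=> v2 w2 v2' w2' vv' ww' phi tphi.
have [Cphi [K [cK KOm phi0]]] := tphi.
have [cphi /(_ i)[dphi [cDphi _]]] := Cphi 1%N.
have {}cphi : continuous phi by move=> x; exact: cphi.
have {}cDphi : continuous (partial i phi) by move=> x; exact: cDphi.
have Dphi0 x : ~ K x -> partial i phi x = 0 by exact: partial_support0.
under eq_Rintegral do rewrite mulrBl.
under [X in _ = - X]eq_Rintegral do rewrite mulrBl.
have iphi z (z2 : in_L2 Om z) := in_L2_integrable_test z2 cK cphi phi0.
have iDphi z (z2 : in_L2 Om z) := in_L2_integrable_test z2 cK cDphi Dphi0.
rewrite (RintegralB _ (iDphi _ v2) (iDphi _ w2))//.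
rewrite (RintegralB _ (iphi _ v2') (iphi _ w2'))//.
by rewrite vv'// ww'// opprB opprK addrC.
Qed.

Lemma H2_withB v Dv D2v w Dw D2w :
  H2_with Om v Dv D2v -> H2_with Om w Dw D2w ->
  H2_with Om (fun x => v x - w x) (fun i x => Dv i x - Dw i x)
    (fun i j x => D2v i j x - D2w i j x).
Proof.
move=> [v2 Hv HHv] [w2 Hw HHw]; split.
- exact: in_L2B.
- move=> i; have [? ?] := Hv i; have [? ?] := Hw i.
  by split; [exact: in_L2B|exact: weak_partialB].
- move=> i j; have [? ?] := Hv i; have [? ?] := Hw i.
  have [? ?] := HHv i j; have [? ?] := HHw i j.
  by split; [exact: in_L2B|exact: weak_partialB].
Qed.

(** Bounded continuous functions on a bounded open set are in L^2, and [weak_partial_C1] makes the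
    classical derivatives weak ones, at both orders. *)
Lemma smooth_spline_H2 m D (V : 'I_m -> simplex) (cs : coefs d m D) r :
  (2 <= r)%N -> smooth_spline V Om r cs ->
  H2_with Om (spline V cs) (fun i => partial i (spline V cs))
    (fun i j => partial j (partial i (spline V cs))).
Proof.
move=> r2 hcs; have [[M0 B0] B1 B2] := smooth_spline_bounded oOm bOm r2 hcs.
case: r r2 hcs => [|[|r]]// _ [cs0 H1].
have L2 h : (forall x, Om x -> {for x, continuous h}) ->
    (exists M : R, forall x, Om x -> `|h x| <= M) -> in_L2 Om h.
  move=> ch [M hM]; apply: (bounded_in_L2 mOm Om_fin _ hM).
  exact: open_continuous_measurable_fun_row.
split.
- by apply: L2 => //; exists M0.
- move=> i; have [ds [cs1 _]] := H1 i.
  by split; [exact: L2|exact: weak_partial_C1].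
- move=> i j; have [_ [cs1 H2]] := H1 i; have [ds /Ck_continuous cs2] := H2 j.
  by split; [exact: L2|exact: weak_partial_C1].
Qed.

Lemma L2norm_le_H2norm v (Dv : 'I_d -> 'rV[R]_d -> R) D2v :
  (L2norm Om v <= H2norm Om v Dv D2v)%E.
Proof.
rewrite /H2norm -addeA leeDl// adde_ge0 ?L2norm_ge0//.
by apply: sume_ge0 => i _; apply: sume_ge0 => j _; exact: L2norm_ge0.
Qed.

End H2_subtraction.

(** [C] is chosen after [Om] but before the operator, the data and the spline, so the constant can
    depend only on [Om] and [A2]. The existence of an admissible [A2] is part of the conclusion. *)
Theorem theorem11 (R : realType) (d : nat) (hd : (2 <= d)%N)
    (Om : set 'rV[R]_d) (hOm : bounded_domain Om)
    (rOm : R) (hrOm : 0 < rOm)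
    (hreach : uniformly_positive_reach (closure Om) rOm) :
  exists C : R -> R,
    (forall A2 : R, 0 < A2 -> 0 < C A2) /\
    forall
      (* the constant A of Om *)
      (A : R) (hA : 0 < A) (hAbound : laplacian_bound Om A)
      (* the operator *)
      (a : 'I_d -> 'I_d -> 'rV[R]_d -> R) (b : 'I_d -> 'rV[R]_d -> R)
      (c1 : 'rV[R]_d -> R)
      (ha : forall i j, in_Linf Om (a i j))
      (hb : forall i, in_Linf Om (b i))
      (hc1 : in_Linf Om c1)
      (hsym : forall i j x, Om x -> a i j x = a j i x)
      (hell : elliptic Om a)
      (eps : R) (heps : 0 < eps <= 1) (hcordes : cordes Om a eps)
      (hsmall : 0 < 1 - Num.sqrt (1 - eps) / A - Cm Om a b c1 / A),
    (exists2 A2 : R, 0 < A2 & operator_bound Om a b c1 A2) /\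
    forall
      (A2 : R) (hA2 : 0 < A2) (hA2bound : operator_bound Om a b c1 A2)
      (* the exact solution *)
      (f g u : 'rV[R]_d -> R)
      (hf : in_L2 Om f)
      (hg : sobolev Om 1 g) (hgc : {within closure Om, continuous g})
      (hu : strong_solution Om a b c1 f u)
      (hug : eq_on_boundary Om u g)
      (hu3 : sobolev Om 3 u)
      (* the triangulation and the spline space *)
      (m : nat) (V : 'I_m -> 'I_d.+1 -> 'rV[R]_d) (hV : triangulation Om V)
      (r D D' : nat) (hr : (2 <= r)%N)
      (hD2 : d = 2%N -> (3 * r + 2 <= D)%N)
      (hD3 : d = 3%N -> (6 * r + 3 <= D)%N)
      (hD' : (D < D')%N)
      (* the spline collocation minimizer *)
      (alpha beta gamma : R)
      (halpha : 0 < alpha) (hbeta : 0 < beta) (hgamma : 0 < gamma)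
      (eps1 : R) (cs : coefs d m D)
      (hcs : smooth_spline V Om r cs)
      (hmin : collocation_minimizer V Om D' r alpha beta gamma
                a b c1 f g eps1 cs)
      (hres : (L2norm Om (fun x =>
                 classical_op a b c1 (spline V cs) x - f x)%R <= eps1%:E)%E)
      (hbd : eq_on_boundary Om (fun x => u x - spline V cs x) (fun=> 0)),
    (L2norm Om (fun x => u x - spline V cs x)%R <= (C A2 * eps1)%:E)%E.
Proof.
have [oOm _ _ bOm] := hOm; have mOm := open_measurable_row oOm.
exists (fun A2 => A2^-1); split=> [A2|]; first by rewrite invr_gt0.
move=> A hA hAbound a b c1 ha hb hc1 _ hell eps heps hcordes hsmall.
split; first exact: (cordes_operator_bound mOm hd hA hAbound ha hb hc1 hell heps).
move=> A2 hA2 hA2bound f g u [mf _] _ _ [Du [D2u [uH2 uf]]] _ _ m V _ r D D' hr.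
move=> _ _ _ alpha beta gamma _ _ _ eps1 cs hcs _ hres.
rewrite /eq_on_boundary; under eq_fun do rewrite subr0; move=> hbd.
have sH2 := smooth_spline_H2 oOm bOm hr hcs.
have wH2 := H2_withB oOm bOm uH2 sH2.
have meas v Dv D2v : H2_with Om v Dv D2v ->
    measurable_fun Om (second_order_op a b c1 v Dv D2v).
  move=> [[mv _] HD HD2]; apply: measurable_second_order_op => //.
  - by move=> i j; have [] := ha i j.
  - by move=> i; have [] := hb i.
  - by case: hc1.
  - by move=> i; have [[]] := HD i.
  - by move=> i j; have [[]] := HD2 i j.
have bound := hA2bound _ _ _ wH2 hbd.
(* With [C A2] equal to [A2^-1], the goal becomes [A2] times the L^2 norm of the error being at most
   [eps1]. *)
rewrite mulrC EFinM lee_pdivlMr// muleC.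
apply: le_trans (le_trans bound (le_trans _ hres)).
  by rewrite lee_pmul2l//; exact: L2norm_le_H2norm.
apply: le_L2norm => //; first exact: meas.
  by apply: measurable_funB => //; exact: meas sH2.
(* Almost everywhere [f] is the operator applied to [u], so by linearity the operator applied to the
   error is the residual up to sign. *)
apply: filterS uf => x ufx Omx; rewrite -(ufx Omx) distrC.
rewrite le_eqVlt; apply/orP; left; apply/eqP; congr `|_|.
rewrite /classical_op /second_order_op.
under eq_bigr do under eq_bigr do rewrite mulrBr.
under [X in _ + X + _ = _]eq_bigr do rewrite mulrBr.
under eq_bigr do rewrite sumrB.
rewrite !sumrB; ring.
Qed.
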